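(* With $u_2=-4K^2$ and $t_3,t_4,t_5,t_6$ the polynomials in $r^2,u_2,\sigma_1,\dots,\sigma_6$ defined in the context, one has $\alpha'_6=\beta'_6\,(\beta'_6)^*$, where $$\beta'_6=\frac{\mathrm{Res}\bigl(t_3^2-4u_2(t_4-2\sqrt{u_2t_6}),\;u_2t_5-t_3\sqrt{u_2t_6},\;r^2\bigr)}{4u_2^6},$$ $(\beta'_6)^*$ is $\beta'_6$ with the opposite sign on $\sqrt{u_2t_6}$, and $\mathrm{Res}(\cdot,\cdot,r^2)$ is the resultant with respect to $r^2$. Here $\alpha'_6$ is regarded as a polynomial in $u_2$ (with $16K^2=-4u_2$) and $\sigma_1,\dots,\sigma_6$.
   Context: An $(n+1)$-gon is semicyclic if it is inscribed in a circle and one of its sides is a diameter of that circle (polygons are oriented and may be non-convex and self-intersecting; the area $K$ is the signed area $\oint x\,dy$). For $n\ge2$, $\alpha'_n$ is the unique irreducible polynomial with integer coefficients in $n+1$ variables, monic in the first variable, homogeneous when the first variable has degree $2$ and the others degree $1$, such that $\alpha'_n(16K^2,a_1^2,\dots,a_n^2)=0$ whenever $a_1,\dots,a_n$ are the lengths of the sides, excluding a diameter, of a semicyclic $(n+1)$-gon of area $K$. It is symmetric in the last $n$ variables, hence a polynomial in $16K^2$ and the elementary symmetric functions $\sigma_1,\dots,\sigma_n$ of $a_1^2,\dots,a_n^2$. Regarding $r^2,u_2,\sigma_1,\dots,\sigma_6$ as indeterminates, define \begin{align*} t_1&=\sigma_1-4r^2,\\ t_2&=-\sigma_2+\tfrac14t_1^2+4r^2t_1-u_2,\\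 t_3&=\sigma_3+\tfrac12t_1t_2-r^2(t_1^2-4t_2),\\ t_4&=-\sigma_4+\tfrac14t_2^2-2r^2t_1t_2,\\ t_5&=\sigma_5-r^2t_2^2,\\ t_6&=-\sigma_6. \end{align*} $\sqrt{u_2t_6}$ is a formal square root of $u_2t_6=-u_2\sigma_6$ (not involving $r^2$). *)

(* Defs.v *)
From HB Require Import structures.
From mathcomp Require Import all_boot all_order all_algebra.
From mathcomp Require Import reals mpoly.

Set Implicit Arguments.
Unset Strict Implicit.
Unset Printing Implicit Defensive.

Import Order.TTheory GRing.Theory Num.Theory.

Local Open Scope ring_scope.

Section Polygons.
Variables (R : realType) (N : nat).

Definition edist (p q : R * R) : R :=
  Num.sqrt ((p.1 - q.1) ^+ 2 + (p.2 - q.2) ^+ 2).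

(* A closed oriented N-gon is the sequence v of its vertices; its i-th side
   runs from v i to v (ordS i), where ordS is the cyclic successor on 'I_N.
   Nothing prevents self-intersections or coinciding vertices. *)
Implicit Type v : 'I_N -> R * R.

Definition side_length v (i : 'I_N) : R := edist (v i) (v (ordS i)).

(* The integral of x dy along the segment from (x0, y0) to (x1, y1) equals
   (x0 + x1) / 2 * (y1 - y0). *)
Definition signed_area v : R :=
  \sum_(i < N) ((v i).1 + (v (ordS i)).1) / 2 * ((v (ordS i)).2 - (v i).2).

(* v is inscribed in a circle of which the d-th side is a diameter: the
   endpoints of that side are antipodal with respect to the centre. *)
Definition semicyclic v (d : 'I_N) : Prop :=
  exists (c : R * R) (r : R),
    [/\ 0 < r, forall i, edist c (v i) = r & v (ordS d) - c = c - v d].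

End Polygons.

(* In {mpoly _[n.+1]} the variable of index
   ord0 stands for 16 K^2 and that of index lift ord0 i for the square of
   the length of the i-th non-diameter side. *)

Definition irreducible_elt (A : unitRingType) (p : A) : Prop :=
  [/\ p != 0, p \isn't a GRing.unit
    & forall q r : A, p = q * r ->
        (q \is a GRing.unit) \/ (r \is a GRing.unit)].

Section AlphaPrime.
Variable n : nat.
Implicit Type p : {mpoly int[n.+1]}.

(* Some pure power of the first variable has coefficient 1, and it is the only
   monomial of p whose degree in the first variable is at least as large. *)
Definition monic_in_first p : Prop :=
  exists d : nat, p@_(U_(ord0) *+ d)%MM = 1 /\
    forall m : 'X_{1..n.+1}, m \in msupp p -> (d <= m ord0)%N ->
      m = (U_(ord0) *+ d)%MM.

Definition weighted_homogeneous p : Prop :=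
  exists w : nat, forall m : 'X_{1..n.+1}, m \in msupp p ->
    (2 * m ord0 + \sum_(i < n) m (lift ord0 i))%N = w.

Definition vanishes_on_semicyclic (R : realType) p : Prop :=
  forall (v : 'I_n.+1 -> R * R) (d : 'I_n.+1), semicyclic v d ->
    (map_mpoly intr p).@[fun j : 'I_n.+1 =>
       if unlift ord0 j is Some i then side_length v (lift d i) ^+ 2
       else 16 * signed_area v ^+ 2] = 0.

Definition is_alpha' (R : realType) p : Prop :=
  [/\ irreducible_elt p, monic_in_first p, weighted_homogeneous p
    & vanishes_on_semicyclic R p].

Definition esym_sides (k : nat) : {mpoly int[n.+1]} :=
  mesym n int k \mPo [tuple 'X_(lift ord0 i) | i < n].

(* A is the expression of p in terms of the first variable (which remains the
   variable of index ord0 of A) and of sigma_1, ..., sigma_n (sigma_k is the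
   variable of index k of A). Such an A is unique, since the elementary
   symmetric polynomials are algebraically independent. *)
Definition sigma_expression p (A : {mpoly int[n.+1]}) : Prop :=
  p = A \mPo [tuple if j == ord0 then 'X_j else esym_sides j | j < n.+1].

(* A as a polynomial in u_2, sigma_1, ..., sigma_n, where the first variable
   of A is -4 u_2. *)
Definition in_u2 (A : {mpoly int[n.+1]}) : {mpoly rat[n.+1]} :=
  map_mpoly intr A \mPo
    [tuple if j == ord0 then (- 4) *: 'X_j else 'X_j | j < n.+1].

End AlphaPrime.

(* Qus is the ring Q[u_2, sigma_1, ..., sigma_6]; the variable 'X of {poly Qus}
   is r^2. *)

Notation Qus := (mpoly.mpoly 7 rat).

Definition u2 : Qus := 'X_ord0.
Definition sigma (k : nat) : Qus := 'X_(inord k).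

Definition t1 : {poly Qus} := (sigma 1)%:P - 4 *: 'X.
Definition t2 : {poly Qus} :=
  - (sigma 2)%:P + (4^-1)%:MP *: t1 ^+ 2 + 4 *: ('X * t1) - u2%:P.
Definition t3 : {poly Qus} :=
  (sigma 3)%:P + (2^-1)%:MP *: (t1 * t2) - 'X * (t1 ^+ 2 - 4 *: t2).
Definition t4 : {poly Qus} :=
  - (sigma 4)%:P + (4^-1)%:MP *: t2 ^+ 2 - 2 *: ('X * t1 * t2).
Definition t5 : {poly Qus} := (sigma 5)%:P - 'X * t2 ^+ 2.
Definition t6 : Qus := - sigma 6.

(* beta'_6, in a field L into which Qus is mapped by iota, where s stands for
   the square root of u_2 t_6; (beta'_6)^* is then the value at - s. The
   polynomials in the resultant have degrees 6 and 5, so the ordering of rows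
   and columns in MathComp's Sylvester matrix does not affect its sign. *)
Section BetaPrime.
Variables (L : fieldType) (iota : {rmorphism Qus -> L}).

Definition beta'6 (s : L) : L :=
  resultant
    (map_poly iota t3 ^+ 2
       - (4 * iota u2) *: (map_poly iota t4 - (2 * s)%:P))
    (iota u2 *: map_poly iota t5 - s *: map_poly iota t3)
  / (4 * iota u2 ^+ 6).

End BetaPrime.

(* Main.v *)
(**
Let F and G be integral multiples of the two polynomials of the statement, D(s) their resultant with respect to r^2 and N = D(s) D(-s), an element of Z[u_2, sigma_1, ..., sigma_6] since s^2 = u_2 t_6 there.

Divisibility by u_2^12: modulo s^2 = u_2 t_6, G is u_2 / s times a polynomial K, and at the roots of G, F equals u_2 / (64 t_6) times a polynomial H, so that t_6^20 N is, up to a constant, u_2^12 times the norm of Res(H, K); as u_2 and t_6 are coprime, N = P u_2^12. Dilation makes P weighted homogeneous of weight 60, and an explicit evaluation gives its leading coefficient 2^196 at u_2^30.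

Vanishing: for a semicyclic heptagon, the product of the T + a_i^2 is T (T + 4 r^2) A^2 + B^2 with A, B quadratic and the leading coefficient of B equal to +-2K; comparing coefficients shows that F and G share the root r^2 for a suitable s, hence P vanishes at u_2 = -4 K^2. Such heptagons exist for a Zariski dense set of side lengths (one long side and five short ones, by the intermediate value theorem).

Irreducibility: for one choice of the a_i^2 modulo 31, an explicit common root of F and G lies in F_31(theta), theta^30 = 3, with u_2 of degree 30. So P stays irreducible for all side lengths in a residue class.

Consequently P divides alpha'_6 over Q[a_1^2, ..., a_6^2], since a nonzero remainder of alpha'_6 modulo P would have a nonzero resultant with P, vanishing on a dense set. By Gauss's lemma alpha'_6 = c P, and monicity gives c = 2^-136.
*)

Require Import Defs.
From HB Require Import structures.
From mathcomp Require Import all_boot all_order all_algebra all_field.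
From mathcomp Require Import ring lra zify.
From mathcomp Require Import reals.
From mathcomp Require Import -(notations) mpoly.
From mathcomp Require Import classical_sets functions topology normedtype realfun trigo.

Import Order.TTheory GRing.Theory Num.Theory numFieldNormedType.Exports.
Set Implicit Arguments.
Unset Strict Implicit.
Unset Printing Implicit Defensive.
Local Open Scope ring_scope.

(** The heptagon identity comes from the half central angles phi_i: a_i = 2 r sin phi_i, and the
    phi_i add up to pi/2. If w^2 = -T (T + 4 r^2), then T (T + a_i^2) is the norm of T cos phi_i + w
    sin phi_i, and the six factors multiply to T^3 (B + w A); the sum of the angles kills the cubic
    term of B and makes A monic. The prime 31 and the equation theta^30 = 3 go together: 3 is a
    primitive root modulo 31, so Frobenius multiplies theta by 3 and has an orbit of length 30, the
    degree of P in u_2. Irreducibility is needed only at numerical points: there the remainder of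
    alpha'_6, of smaller degree than P, cannot share a factor with P, so its leading coefficient
    vanishes; a residue class is already Zariski dense. Powers of 2: F and G are 64 times the
    polynomials of the statement, so D is 64^11 = 2^66 times their resultant, and the two
    denominators 4 u_2^6 bring the factor between P and the product of the two beta' to 2^136. It
    agrees with 2^196 / 4^30. *)

(** * Zariski density of products of infinite sets *)

Lemma poly_eq0_inj (K : idomainType) (q : {poly K}) (e : nat -> K) :
  injective e -> (forall k, q.[e k] = 0) -> q = 0.
Proof.
move=> e_inj q0; apply/eqP; case: (altP (q =P 0)) => // q_neq0.
have := max_poly_roots (rs := map e (iota 0 (size q))) q_neq0.
rewrite map_inj_uniq // iota_uniq size_map size_iota ltnn.
move=> H; suff: false by []. apply: H => //.
by apply/allP=> _ /mapP[k _ ->]; apply/rootP.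
Qed.

Lemma meval_muni (R : comNzRingType) n (p : mpoly n.+1 R) (v : 'I_n.+1 -> R) :
  meval v p =
  (map_poly (meval (fun i => v (widen_ord (leqnSn n) i))) (muni p)).[v ord_max].
Proof.
rewrite muniE rmorph_sum /= horner_sum mevalE; apply: eq_bigr => m _.
rewrite map_polyZ /= map_polyXn hornerZ hornerXn mevalZ mevalX.
rewrite big_ord_recr /= mulrA; congr (_ * _ * _).
by apply: eq_bigr => i _; rewrite mnmE.
Qed.

Lemma coef_muni (R : nzRingType) n (p : mpoly n.+1 R) (m : multinom n.+1) :
  mcoeff (Multinom [tuple m (widen_ord (leqnSn n) i) | i < n])
    ((muni p)`_(m ord_max)) = mcoeff m p.
Proof.
rewrite muniE coef_sum raddf_sum /= [in RHS](mpolyE p) [in RHS]raddf_sum /=.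
apply: eq_bigr => k _; rewrite coefZ coefXn mcoeffZ mcoeffX.
have [/eqP e|] := boolP (k == m); first by rewrite e eqxx !mulr1 mcoeffZ mcoeffX eqxx mulr1.
move=> neq; rewrite mulr0.
case: eqP => [eqm|]; rewrite ?mulr0 ?mcoeff0 //.
rewrite mulr1 mcoeffZ mcoeffX; case: eqP => [eq2|]; rewrite ?mulr0 //.
case/eqP: neq; apply/mnmP => i.
have [j ->|->] := unliftP ord_max i; last by [].
have := congr1 (fun x : multinom n => x j) eq2; rewrite /= !mnmE.
by rewrite (_ : widen_ord _ j = lift ord_max j) //; apply: val_inj; rewrite /= /bump leqNgt ltn_ord.
Qed.

Lemma muni_eq0 (R : nzRingType) n (p : mpoly n.+1 R) : muni p = 0 -> p = 0.
Proof.
by move=> p0; apply/mpolyP => m; rewrite -coef_muni p0 coef0 !mcoeff0.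
Qed.

(** Induction on the number of variables: once the first n coordinates are fixed, the polynomial in
    the last one has infinitely many roots, so each of its coefficients vanishes at those
    coordinates. *)
Lemma mpoly_eq0_dense (K : idomainType) n (h : mpoly n K) (e : 'I_n -> nat -> K) :
  (forall i, injective (e i)) ->
  (forall k : 'I_n -> nat, meval (fun i => e i (k i)) h = 0) -> h = 0.
Proof.
elim: n h e => [|n IHn] h e e_inj h0.
  apply/mpolyP => m; have := h0 (fun _ => 0%N).
  rewrite [h]mpolyE raddf_sum /= raddf_sum mcoeff0 /= => h1.
  rewrite -[RHS]h1; apply: eq_bigr => k _.
  rewrite mevalZ mevalX big_ord0 mcoeffZ mcoeffX.
  by rewrite (_ : k = m) ?eqxx //; apply/mnmP => -[].
apply: muni_eq0; apply/polyP => j; rewrite coef0.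
apply: (IHn _ (fun i => e (widen_ord (leqnSn n) i))) => [i|k]; first exact: e_inj.
set v := (X in meval X).
suff: map_poly (meval v) (muni h) = 0 by move/polyP/(_ j); rewrite coef_map coef0.
apply: (poly_eq0_inj (e_inj ord_max)) => l.
pose k' i := if unlift ord_max i is Some i' then k i' else l.
rewrite -[RHS](h0 k') meval_muni /k' unlift_none.
congr (_.[_]); apply: eq_map_poly => q; apply: meval_eq => i.
rewrite /v (_ : widen_ord _ i = lift ord_max i) ?liftK //.
by apply: val_inj; rewrite /= /bump leqNgt ltn_ord.
Qed.

(** * Resultants as products over roots *)

Lemma horner_sum_coef (R : nzSemiRingType) (p : {poly R}) n x : (size p <= n)%N ->
  \sum_(i < n) p`_i * x ^+ i = p.[x].
Proof.
move=> le_pn; rewrite -{2}[p](@take_poly_id _ n) // horner_poly.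
exact: eq_bigr.
Qed.

(** Multiply the Sylvester matrix by a matrix whose first columns are the power vectors of the roots
    b_j: the rows of p give b_j^i p(b_j), those of q give 0. The product is block triangular, with
    one block Vandermonde times diag(p(b_j)) and one triangular block carrying the leading
    coefficient of q on its diagonal. The Vandermonde determinant, nonzero for distinct roots,
    cancels. *)
Lemma resultant_distinct_roots (R : idomainType) (p q : {poly R})
    (b : 'I_(size q).-1 -> R) :
  p != 0 -> q != 0 -> injective b -> (forall i, root q (b i)) ->
  resultant p q = lead_coef q ^+ (size p).-1 * \prod_i p.[b i].
Proof.
move=> p0 q0 b_inj qb0.
set n := (size q).-1; set m := (size p).-1.
have sp : size p = m.+1 by rewrite /m -polySpred.
have sq : size q = n.+1 by rewrite /n -polySpred.
pose S : 'M_(n + m) := Sylvester_mx p q.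
have SpE (i : 'I_n) j : S (lshift m i) j = ('X^i * p)`_j.
  rewrite /S Sylvester_mxE; case: splitP => [k /= /ord_inj <-|k /= ik].
    by rewrite coefXnM ltnNge; case: leqP.
  by have := ltn_ord i; rewrite ik ltnNge leq_addr.
have SqE (i : 'I_m) j : S (rshift n i) j = ('X^i * q)`_j.
  rewrite /S Sylvester_mxE; case: splitP => [k /= ik|k /= /eqP].
    by have := ltn_ord k; rewrite -ik ltnNge leq_addr.
  by rewrite eqn_add2l => /eqP/ord_inj <-; rewrite coefXnM ltnNge; case: leqP.
pose V := Vandermonde n (\row_i b i).
pose M : 'M_(n + m) :=
  block_mx V 0 (\matrix_(i < m, j < n) b j ^+ (n + i)) 1%:M.
have detV : \det V != 0.
  rewrite det_Vandermonde; apply/prodf_neq0 => i _; apply/prodf_neq0 => j ij.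
  rewrite !mxE subr_eq0; apply: contraTneq ij => /b_inj ->; rewrite ltnn //.
have detM : \det M = \det V by rewrite det_lblock det1 mulr1.
have Ml k j : M k (lshift m j) = b j ^+ k.
  case: (splitP k) => i ki.
    by rewrite (_ : k = lshift m i) ?block_mxEul ?mxE //; apply/ord_inj.
  by rewrite (_ : k = rshift n i) ?block_mxEdl ?mxE //; apply/ord_inj.
have Mr k j : M k (rshift n j) = (k == rshift n j)%:R.
  case: (splitP k) => i ki.
    rewrite (_ : k = lshift m i) ?block_mxEur ?mxE //; last exact/ord_inj.
    by rewrite eq_lrshift.
  rewrite (_ : k = rshift n i) ?block_mxEdr ?mxE //; last exact/ord_inj.
  by rewrite eq_rshift.
pose P := \matrix_(i < n, j < m) (S *m M) (lshift m i) (rshift n j).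
have SM : S *m M =
    block_mx (V *m diag_mx (\row_j p.[b j])) P 0
             (\matrix_(i < m, j < m) ('X^i * q)`_(n + j)).
  apply/matrixP => i j; case: (splitP i) => i' ii';
    case: (splitP j) => j' jj'.
  - have -> : i = lshift m i' by exact/ord_inj.
    have -> : j = lshift m j' by exact/ord_inj.
    rewrite block_mxEul mxE mul_mx_diag !mxE.
    under eq_bigr do rewrite SpE Ml.
    rewrite horner_sum_coef ?hornerM ?hornerXn //.
    rewrite size_monicM ?monicXn // size_polyXn sp /=.
    by have := ltn_ord i'; lia.
  - have -> : i = lshift m i' by exact/ord_inj.
    have -> : j = rshift n j' by exact/ord_inj.
    by rewrite block_mxEur [RHS]mxE.
  - have -> : i = rshift n i' by exact/ord_inj.
    have -> : j = lshift m j' by exact/ord_inj.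
    rewrite block_mxEdl mxE [RHS]mxE.
    under eq_bigr do rewrite SqE Ml.
    rewrite horner_sum_coef ?hornerM ?hornerXn //.
      by rewrite (rootP (qb0 j')) mulr0.
    rewrite size_monicM ?monicXn // size_polyXn sq /=.
    by have := ltn_ord i'; lia.
  - have -> : i = rshift n i' by exact/ord_inj.
    have -> : j = rshift n j' by exact/ord_inj.
    rewrite block_mxEdr mxE [RHS]mxE.
    under eq_bigr do rewrite SqE Mr.
    by rewrite (bigD1 (rshift n j')) //= eqxx mulr1 big1 ?addr0 // => k /negbTE ->; rewrite mulr0.
apply: (mulIf detV); rewrite -{1}detM -[resultant p q]/(\det S) -det_mulmx SM.
rewrite det_ublock det_mulmx det_diag [X in _ * X = _]det_trig; last first.
  apply/is_trig_mxP => i j ij; rewrite mxE coefXnM; case: ifP => // _.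
  by apply: nth_default; rewrite sq; lia.
rewrite (eq_bigr (fun i => p.[b i])) => [|i _]; last by rewrite mxE.
have -> : \prod_(i < m) (\matrix_(i < m, j < m) ('X^i * q)`_(n + j)) i i =
    lead_coef q ^+ m.
  rewrite -[m in RHS]card_ord -prodr_const; apply: eq_bigr => i _.
  by rewrite mxE coefXnM lead_coefE ltnNge leq_addl /= addnK.
by rewrite mulrC mulrA mulrAC.
Qed.

Lemma resultant_uniq_roots (R : idomainType) (p q : {poly R}) (rs : seq R) :
  p != 0 -> q != 0 -> uniq rs -> size rs = (size q).-1 -> all (root q) rs ->
  resultant p q = lead_coef q ^+ (size p).-1 * \prod_(b <- rs) p.[b].
Proof.
move=> p0 q0 rs_uniq srs /(all_nthP 0) rs_root.
rewrite (@resultant_distinct_roots R p q (fun i => rs`_i)) //.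
- by rewrite (big_nth 0) srs big_mkord.
- move=> i j /eqP; rewrite nth_uniq ?srs ?ltn_ord // => /eqP.
  exact/ord_inj.
- by move=> i; apply: rs_root; rewrite srs.
Qed.

(** Both degrees are preserved, hence so is the shape of the Sylvester matrix. *)
Lemma resultant_map (aR rR : nzRingType) (f : {rmorphism aR -> rR})
    (p q : {poly aR}) :
  f (lead_coef p) != 0 -> f (lead_coef q) != 0 ->
  f (resultant p q) = resultant (map_poly f p) (map_poly f q).
Proof.
move=> fp0 fq0; rewrite /resultant /Sylvester_mx.
rewrite (size_map_poly_id0 fp0) (size_map_poly_id0 fq0) -det_map_mx map_col_mx.
by congr (\det (col_mx _ _)); apply: map_lin1_mx => v /=;
  rewrite map_poly_rV rmorphM /= map_rVpoly.
Qed.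

(** Repeated roots are reached from the generic case: over K[X_1, ..., X_n] the indeterminates are
    distinct roots, and the identity obtained there is specialised by [ev] to the given roots. *)
Lemma resultant_roots (K : fieldType) (p : {poly K}) (c : K) (rs : seq K) :
  p != 0 -> c != 0 ->
  resultant p (c *: \prod_(b <- rs) ('X - b%:P)) =
  c ^+ (size p).-1 * \prod_(b <- rs) p.[b].
Proof.
have [n [t ->]] : exists n, exists t : n.-tuple K, rs = t.
  by exists (size rs), (in_tuple rs).
move=> p0 c0 {rs}.
pose X (i : 'I_n) : mpoly n K := mpolyX K (mnm1 i).
pose C := @mpolyC n K.
pose ev : {rmorphism mpoly n K -> K} := meval (tnth t).
pose p' := map_poly C p; pose q' := C c *: \prod_(b <- codom X) ('X - b%:P).
have evC x : ev (C x) = x by apply: mevalC.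
have mpolyC_injective : injective C.
  by move=> x y /(congr1 ev); rewrite !evC.
have C0 x : x != 0 -> C x != 0 by rewrite mpolyC_eq0.
have evX i : ev (X i) = tnth t i by apply: mevalXU.
have lq' : lead_coef q' = C c.
  by rewrite lead_coefZ (monicP (monic_prod_XsubC _ _ _)) mulr1.
have sX : size (codom X) = n by rewrite size_codom card_ord.
have sq' : size q' = n.+1.
  by rewrite size_scale ?C0 // size_prod_XsubC sX.
have mp' : map_poly ev p' = p.
  by rewrite -map_poly_comp (eq_map_poly (g := id)) ?map_poly_id.
have codomE : map ev (codom X) = t.
  rewrite /codom /image_mem -map_comp -[tval t in RHS](map_tnth_enum t).
  by rewrite enumT; apply: eq_map => i /=; rewrite evX.
have mq' : map_poly ev q' = c *: \prod_(b <- t) ('X - b%:P).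
  rewrite map_polyZ rmorph_prod /=; congr (_ *: _); first by rewrite evC.
  rewrite -codomE [RHS]big_map; apply: eq_bigr => b _.
  by rewrite map_polyXsubC.
have lp' : lead_coef p' = C (lead_coef p).
  by rewrite lead_coef_map_inj //; apply: mpolyC_injective.
rewrite -mq' -mp' -resultant_map; first last.
- by rewrite lq' evC.
- by rewrite lp' evC lead_coef_eq0.
rewrite (@resultant_uniq_roots _ p' q' (codom X)).
- rewrite rmorphM rmorphXn lq' /= evC mp' size_map_inj_poly //.
  + congr (_ * _); rewrite -codomE rmorph_prod /= [RHS]big_map.
    by apply: eq_bigr => b _; rewrite -[in RHS]mp' horner_map.
- by rewrite -lead_coef_eq0 lp' C0 // lead_coef_eq0.
- by rewrite -size_poly_eq0 sq'.
- apply/injectiveP => i j /(congr1 (mcoeff (mnm1 j))).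
  rewrite !mcoeffXU eqxx; case: eqP => // _ /eqP; by rewrite eq_sym oner_eq0.
- by rewrite sX sq'.
- by apply/allP => b bX; rewrite rootZ ?C0 // root_prod_XsubC.
Qed.

Lemma resultantZ (R : idomainType) (c d : R) (p q : {poly R}) :
  c != 0 -> d != 0 ->
  resultant (c *: p) (d *: q) = c ^+ (size q).-1 * d ^+ (size p).-1 * resultant p q.
Proof.
move=> c0 d0; rewrite /resultant /Sylvester_mx (size_scale _ c0) (size_scale _ d0).
set A := lin1_mx (_ \o (_ \o* _)); set B := lin1_mx (_ \o (_ \o* _)).
set A' := lin1_mx (_ \o (p \o* _)); set B' := lin1_mx (_ \o (q \o* _)).
have -> : A = c *: A' by apply/matrixP => i j; rewrite !mxE /= -scalerAr coefZ.
have -> : B = d *: B' by apply/matrixP => i j; rewrite !mxE /= -scalerAr coefZ.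
have -> : col_mx (c *: A') (d *: B') =
    block_mx c%:M 0 0 d%:M *m col_mx A' B'.
  by rewrite mul_block_col !mul0mx addr0 add0r !mul_scalar_mx.
by rewrite det_mulmx det_ublock !det_scalar.
Qed.

(** A degree bound together with a coefficient that is allowed to vanish. Unlike [lead_coef], it
    passes to sums and products over any ring; the true degree is read off at the end by
    [has_top_lead]. *)
Definition has_top (R : nzRingType) n (c : R) (p : {poly R}) :=
  (size p <= n.+1)%N /\ p`_n = c.

Lemma has_topC (R : nzRingType) (c : R) : has_top 0 c c%:P.
Proof. by split; [rewrite size_polyC; case: eqP | rewrite coefC]. Qed.

Lemma has_topX (R : nzRingType) : has_top 1 1 ('X : {poly R}).
Proof. by split; [rewrite size_polyX | rewrite coefX]. Qed.

Lemma has_topW (R : nzRingType) m n (c : R) p : (m < n)%N ->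
  has_top m c p -> has_top n 0 p.
Proof.
by move=> mn [sp _]; split; [|apply: nth_default]; apply: leq_trans sp _; lia.
Qed.

Lemma has_topD (R : nzRingType) n (c d : R) p q :
  has_top n c p -> has_top n d q -> has_top n (c + d) (p + q).
Proof.
move=> [sp cp] [sq cq]; split; last by rewrite coefD cp cq.
by rewrite (leq_trans (size_polyD _ _)) // geq_max sp sq.
Qed.

Lemma has_topN (R : nzRingType) n (c : R) p :
  has_top n c p -> has_top n (- c) (- p).
Proof. by move=> [sp cp]; split; [rewrite size_polyN | rewrite coefN cp]. Qed.

Lemma has_topM (R : nzRingType) m n (c d : R) p q :
  has_top m c p -> has_top n d q -> has_top (m + n) (c * d) (p * q).
Proof.
move=> [sp cp] [sq cq]; split.
  by rewrite (leq_trans (size_polyMleq _ _)) //; lia.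
have mlt : (m < (m + n).+1)%N by lia.
rewrite coefM (bigD1 (Ordinal mlt)) //= addKn cp cq big1 ?addr0 // => i.
rewrite -val_eqE /= => im; have [mi|im'] := ltnP m i.
  by rewrite nth_default ?mul0r // (leq_trans sp).
by rewrite [q`__]nth_default ?mulr0 // (leq_trans sq) //; lia.
Qed.

Lemma has_top_nat (R : nzRingType) n : has_top 0 n%:R (n%:R : {poly R}).
Proof. by rewrite -polyC_natr; apply: has_topC. Qed.

Lemma has_top_lead (R : nzRingType) n (c : R) p : c != 0 ->
  has_top n c p -> size p = n.+1 /\ lead_coef p = c.
Proof.
move=> c0 [sp cp]; have szp : size p = n.+1.
  apply/eqP; rewrite eqn_leq sp ltnNge; apply: contra_neqN c0 => ?.
  by rewrite -cp nth_default.
by rewrite lead_coefE szp.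
Qed.

(** * The elimination system and its resultant *)

Section EliminationSystem.
Variable A : comNzRingType.
Implicit Types (x u s : A) (e : nat -> A).

(* With x = r^2 these are t_1, 4 t_2, 8 t_3, 64 t_4 and 64 t_5, which have integral coefficients. *)
Definition T1 x e : A := e 1%N - 4 * x.
Definition T2 x u e : A := T1 x e ^+ 2 - 4 * e 2%N + 16 * x * T1 x e - 4 * u.
Definition T3 x u e : A :=
  8 * e 3%N + T1 x e * T2 x u e - 8 * x * (T1 x e ^+ 2 - T2 x u e).
Definition T4 x u e : A :=
  T2 x u e ^+ 2 - 64 * e 4%N - 32 * x * T1 x e * T2 x u e.
Definition T5 x u e : A := 64 * e 5%N - 4 * x * T2 x u e ^+ 2.
(** [Fval] and [Gval] are 64 times the two polynomials of the statement. Exchanging (u_2, t_3) with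
    (t_6, t_5) turns them into [Hval] and [Kval], up to constant factors. Values in an arbitrary
    ring serve for numbers, for polynomials in r^2 and for resultants alike. *)
Definition Fval x u s e : A :=
  T3 x u e ^+ 2 - 4 * u * (T4 x u e - 128 * s).
Definition Gval x u s e : A := u * T5 x u e - 8 * s * T3 x u e.
Definition Hval x u s e : A :=
  T5 x u e ^+ 2 + 256 * e 6%N * (T4 x u e - 128 * s).
Definition Kval x u s e : A := s * T5 x u e + 8 * e 6%N * T3 x u e.

End EliminationSystem.

Section EliminationMorphism.
Variables (A B : comNzRingType) (f : {rmorphism A -> B}).
Implicit Types (x u s : A) (e : nat -> A).

Let morphT1 x e : f (T1 x e) = T1 (f x) (f \o e).
Proof. by rewrite /T1 !(rmorph_nat, rmorphB, rmorphM). Qed.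
Let morphT2 x u e : f (T2 x u e) = T2 (f x) (f u) (f \o e).
Proof. by rewrite /T2 !(morphT1, rmorph_nat, rmorphXn, rmorphB, rmorphM, rmorphD). Qed.
Let morphT3 x u e : f (T3 x u e) = T3 (f x) (f u) (f \o e).
Proof. by rewrite /T3 !(morphT1, morphT2, rmorph_nat, rmorphXn, rmorphB, rmorphM, rmorphD). Qed.
Let morphT4 x u e : f (T4 x u e) = T4 (f x) (f u) (f \o e).
Proof. by rewrite /T4 !(morphT1, morphT2, rmorph_nat, rmorphXn, rmorphB, rmorphM, rmorphD). Qed.
Let morphT5 x u e : f (T5 x u e) = T5 (f x) (f u) (f \o e).
Proof. by rewrite /T5 !(morphT1, morphT2, rmorph_nat, rmorphXn, rmorphB, rmorphM, rmorphD). Qed.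

Lemma morph_Fval x u s e : f (Fval x u s e) = Fval (f x) (f u) (f s) (f \o e).
Proof. by rewrite /Fval !(morphT3, morphT4, rmorph_nat, rmorphXn, rmorphB, rmorphM, rmorphD). Qed.
Lemma morph_Gval x u s e : f (Gval x u s e) = Gval (f x) (f u) (f s) (f \o e).
Proof. by rewrite /Gval !(morphT3, morphT5, rmorph_nat, rmorphXn, rmorphB, rmorphM, rmorphD). Qed.
Lemma morph_Hval x u s e : f (Hval x u s e) = Hval (f x) (f u) (f s) (f \o e).
Proof. by rewrite /Hval !(morphT4, morphT5, rmorph_nat, rmorphXn, rmorphB, rmorphM, rmorphD). Qed.
Lemma morph_Kval x u s e : f (Kval x u s e) = Kval (f x) (f u) (f s) (f \o e).
Proof. by rewrite /Kval !(morphT3, morphT5, rmorph_nat, rmorphXn, rmorphB, rmorphM, rmorphD). Qed.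

End EliminationMorphism.

Section EliminationPolynomials.
Variable R : comNzRingType.
Implicit Types (x u s : R) (e : nat -> R).

Definition Fpol u s e : {poly R} := Fval 'X u%:P s%:P (polyC \o e).
Definition Gpol u s e : {poly R} := Gval 'X u%:P s%:P (polyC \o e).
Definition Hpol u s e : {poly R} := Hval 'X u%:P s%:P (polyC \o e).
Definition Kpol u s e : {poly R} := Kval 'X u%:P s%:P (polyC \o e).

Lemma has_topE n (c d : R) p : has_top n c p -> c = d -> has_top n d p.
Proof. by move=> h <-. Qed.

Let X := @has_topX R.
Let N k := @has_top_nat R k.

Let topT1 e : has_top 1 (- 4%:R) (T1 'X (polyC \o e)).
Proof.
apply: (has_topE (has_topD (has_topW _ (has_topC (e 1%N)))
  (has_topN (has_topM (N 4) X)))) => //.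
by ring.
Qed.

Let topT2 u e : has_top 2 (- 48%:R) (T2 'X u%:P (polyC \o e)).
Proof.
have t := topT1 e; rewrite /T2 expr2.
apply: (has_topE (has_topD (has_topD (has_topD (has_topM t t)
  (has_topW _ (has_topN (has_topM (N 4) (has_topC (e 2%N))))))
  (has_topM (has_topM (N 16) X) t))
  (has_topW _ (has_topN (has_topM (N 4) (has_topC u)))))) => //.
by ring.
Qed.

Let topT3 u e : has_top 3 (- 320%:R) (T3 'X u%:P (polyC \o e)).
Proof.
have t := topT1 e; have t' := topT2 u e; rewrite /T3 expr2.
apply: (has_topE (has_topD (has_topD
  (has_topW _ (has_topM (N 8) (has_topC (e 3%N)))) (has_topM t t'))
  (has_topN (has_topM (has_topM (N 8) X)
     (has_topD (has_topM t t) (has_topN t')))))) => //.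
by ring.
Qed.

Let topT4 u e : has_top 4 (- 3840%:R) (T4 'X u%:P (polyC \o e)).
Proof.
have t := topT1 e; have t' := topT2 u e; rewrite /T4 expr2.
apply: (has_topE (has_topD (has_topD (has_topM t' t')
  (has_topW _ (has_topN (has_topM (N 64) (has_topC (e 4%N))))))
  (has_topN (has_topM (has_topM (has_topM (N 32) X) t) t')))) => //.
by ring.
Qed.

Let topT5 u e : has_top 5 (- 96%:R ^+ 2) (T5 'X u%:P (polyC \o e)).
Proof.
have t' := topT2 u e; rewrite /T5 expr2.
apply: (has_topE (has_topD (has_topW _ (has_topM (N 64) (has_topC (e 5%N))))
  (has_topN (has_topM (has_topM (N 4) X) (has_topM t' t'))))) => //.
by ring.
Qed.

Lemma top_Fpol u s e : has_top 6 (320%:R ^+ 2) (Fpol u s e).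
Proof.
have t := topT3 u e; have t' := topT4 u e; rewrite /Fpol /Fval expr2.
apply: (has_topE (has_topD (has_topM t t) (has_topW _ (has_topN
  (has_topM (has_topM (N 4) (has_topC u)) (has_topD t' (has_topW _ (has_topN
     (has_topM (N 128) (has_topC s)))))))))) => //.
by ring.
Qed.

Lemma top_Gpol u s e : has_top 5 (- 96%:R ^+ 2 * u) (Gpol u s e).
Proof.
have t := topT3 u e; have t' := topT5 u e; rewrite /Gpol /Gval.
apply: (has_topE (has_topD (has_topM (has_topC u) t') (has_topW _ (has_topN
  (has_topM (has_topM (N 8) (has_topC s)) t))))) => //.
by ring.
Qed.

Lemma top_Hpol u s e : has_top 10 (96%:R ^+ 4) (Hpol u s e).
Proof.
have t := topT4 u e; have t' := topT5 u e; rewrite /Hpol /Hval expr2.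
apply: (has_topE (has_topD (has_topM t' t') (has_topW _
  (has_topM (has_topM (N 256) (has_topC (e 6%N))) (has_topD t (has_topW _ (has_topN
     (has_topM (N 128) (has_topC s))))))))) => //.
by ring.
Qed.

Lemma top_Kpol u s e : has_top 5 (- 96%:R ^+ 2 * s) (Kpol u s e).
Proof.
have t := topT3 u e; have t' := topT5 u e; rewrite /Kpol /Kval.
apply: (has_topE (has_topD (has_topM (has_topC s) t') (has_topW _
  (has_topM (has_topM (N 8) (has_topC (e 6%N))) t)))) => //.
by ring.
Qed.

End EliminationPolynomials.

Section EliminationExtensionality.
Variables (A : comNzRingType) (e e' : nat -> A).
Hypothesis ee' : e =1 e'.

Lemma eq_Fval x u s : Fval x u s e = Fval x u s e'.
Proof. by rewrite /Fval /T3 /T4 /T2 /T1 !ee'. Qed.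
Lemma eq_Gval x u s : Gval x u s e = Gval x u s e'.
Proof. by rewrite /Gval /T3 /T5 /T2 /T1 !ee'. Qed.
Lemma eq_Hval x u s : Hval x u s e = Hval x u s e'.
Proof. by rewrite /Hval /T5 /T4 /T2 /T1 !ee'. Qed.
Lemma eq_Kval x u s : Kval x u s e = Kval x u s e'.
Proof. by rewrite /Kval /T3 /T5 /T2 /T1 !ee'. Qed.

End EliminationExtensionality.

Section EliminationMap.
Variables (A B : comNzRingType) (f : {rmorphism A -> B}) (u s : A) (e : nat -> A).

Let ext : map_poly f \o (polyC \o e) =1 polyC \o (f \o e).
Proof. by move=> k; rewrite /= map_polyC. Qed.

Lemma map_Fpol : map_poly f (Fpol u s e) = Fpol (f u) (f s) (f \o e).
Proof. by rewrite /Fpol morph_Fval (eq_Fval ext) /= map_polyX !map_polyC. Qed.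
Lemma map_Gpol : map_poly f (Gpol u s e) = Gpol (f u) (f s) (f \o e).
Proof. by rewrite /Gpol morph_Gval (eq_Gval ext) /= map_polyX !map_polyC. Qed.
Lemma map_Hpol : map_poly f (Hpol u s e) = Hpol (f u) (f s) (f \o e).
Proof. by rewrite /Hpol morph_Hval (eq_Hval ext) /= map_polyX !map_polyC. Qed.
Lemma map_Kpol : map_poly f (Kpol u s e) = Kpol (f u) (f s) (f \o e).
Proof. by rewrite /Kpol morph_Kval (eq_Kval ext) /= map_polyX !map_polyC. Qed.

End EliminationMap.

Section EliminationHorner.
Variables (A : comNzRingType) (u s x : A) (e : nat -> A).

Let ext : horner_eval x \o (polyC \o e) =1 e.
Proof. by move=> k; rewrite /= /horner_eval hornerC. Qed.
Let hE (p : {poly A}) : p.[x] = horner_eval x p. Proof. by []. Qed.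

Lemma horner_Fpol : (Fpol u s e).[x] = Fval x u s e.
Proof.
by rewrite hE /Fpol morph_Fval (eq_Fval ext) /= /horner_eval hornerX !hornerC.
Qed.
Lemma horner_Gpol : (Gpol u s e).[x] = Gval x u s e.
Proof.
by rewrite hE /Gpol morph_Gval (eq_Gval ext) /= /horner_eval hornerX !hornerC.
Qed.
Lemma horner_Hpol : (Hpol u s e).[x] = Hval x u s e.
Proof.
by rewrite hE /Hpol morph_Hval (eq_Hval ext) /= /horner_eval hornerX !hornerC.
Qed.

End EliminationHorner.

(** * The resultants over Z[u_2, sigma_1, ..., sigma_6][s] *)

Notation Zus := (mpoly 7 int).

Definition zu2 : Zus := mpolyX int (mnm1 ord0).
Definition zsigma (k : nat) : Zus := mpolyX int (mnm1 (inord k)).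

(** The square root of u_2 t_6 is an independent indeterminate here, the ['X] of [{poly Zus}]; its
    square is prescribed only in [Znorm]. *)
Definition Dres : {poly Zus} :=
  resultant (Fpol zu2%:P 'X (polyC \o zsigma)) (Gpol zu2%:P 'X (polyC \o zsigma)).
Definition Eres : {poly Zus} :=
  resultant (Hpol zu2%:P 'X (polyC \o zsigma)) (Kpol zu2%:P 'X (polyC \o zsigma)).

Section DresValues.
Variables (K : comNzRingType) (phi : {rmorphism Zus -> K}) (s : K).

Let ev : {rmorphism {poly Zus} -> K} := horner_eval s \o map_poly phi.
Let evC c : ev c%:P = phi c.
Proof. by rewrite /ev /= /horner_eval map_polyC hornerC. Qed.
Let evX : ev 'X = s.
Proof. by rewrite /ev /= /horner_eval map_polyX hornerX. Qed.
Let ext : ev \o (polyC \o zsigma) =1 phi \o zsigma.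
Proof. by move=> k; exact: evC. Qed.

Let zu2_neq0 : zu2 != 0.
Proof. by rewrite -msupp_eq0 msuppX. Qed.

(** The resultant lies in the ideal generated by F and G, and this identity is transported by the
    evaluation; it thus applies over the reals as well as in characteristic 31. *)
Lemma Dres_common_root y :
  Fval y (phi zu2) s (phi \o zsigma) = 0 ->
  Gval y (phi zu2) s (phi \o zsigma) = 0 -> (map_poly phi Dres).[s] = 0.
Proof.
move=> Fy Gy.
have nat0 k : k.+1%:R != 0 :> {poly Zus}.
  by rewrite -polyC_natr polyC_eq0 -mpolyC_nat mpolyC_eq0 pnatr_eq0.
have [|szF _] := has_top_lead _ (top_Fpol zu2%:P 'X (polyC \o zsigma)).
  by rewrite expf_neq0.
have [|szG _] := has_top_lead _ (top_Gpol zu2%:P 'X (polyC \o zsigma)).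
  by rewrite mulf_neq0 ?polyC_eq0 ?oppr_eq0 ?expf_neq0.
have [||[p q] /= _ DE] := @resultant_in_ideal _ (Fpol zu2%:P 'X (polyC \o zsigma))
  (Gpol zu2%:P 'X (polyC \o zsigma)).
- by rewrite szF.
- by rewrite szG.
rewrite -[LHS]/(ev Dres).
have := congr1 (fun r => (map_poly ev r).[y]) DE.
rewrite map_polyC hornerC => ->.
rewrite rmorphD 2!rmorphM /= map_Fpol map_Gpol hornerD 2!hornerM horner_Fpol horner_Gpol.
by rewrite (eq_Fval ext) (eq_Gval ext) evC evX Fy Gy !mulr0 addr0.
Qed.

End DresValues.

Section DresIdomain.
Variables (K : idomainType) (phi : {rmorphism Zus -> K}) (s : K).
Hypothesis char0 : forall k, k.+1%:R != 0 :> K.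

Let ev : {rmorphism {poly Zus} -> K} := horner_eval s \o map_poly phi.
Let evC c : ev c%:P = phi c.
Proof. by rewrite /ev /= /horner_eval map_polyC hornerC. Qed.
Let evX : ev 'X = s.
Proof. by rewrite /ev /= /horner_eval map_polyX hornerX. Qed.
Let ext : ev \o (polyC \o zsigma) =1 phi \o zsigma.
Proof. by move=> k; exact: evC. Qed.
Let ext' : polyC \o (ev \o (polyC \o zsigma)) =1 polyC \o (phi \o zsigma).
Proof. by move=> k; exact: (congr1 polyC (ext k)). Qed.

Let natZ k : k.+1%:R != 0 :> {poly Zus}.
Proof. by rewrite -polyC_natr polyC_eq0 -mpolyC_nat mpolyC_eq0 pnatr_eq0. Qed.
Let zu2_neq0 : zu2 != 0.
Proof. by rewrite -msupp_eq0 msuppX. Qed.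

(** The leading coefficients 320^2 and -96^2 u_2 survive the evaluation, so the resultant commutes
    with it. *)
Lemma Dres_resultant : phi zu2 != 0 ->
  (map_poly phi Dres).[s] = resultant (Fpol (phi zu2) s (phi \o zsigma))
                                      (Gpol (phi zu2) s (phi \o zsigma)).
Proof.
move=> u0.
have [|_ lF] := has_top_lead _ (top_Fpol zu2%:P 'X (polyC \o zsigma)).
  by rewrite expf_neq0.
have [|_ lG] := has_top_lead _ (top_Gpol zu2%:P 'X (polyC \o zsigma)).
  by rewrite mulf_neq0 ?polyC_eq0 ?oppr_eq0 ?expf_neq0.
rewrite -[LHS]/(ev Dres) /Dres resultant_map ?lF ?lG.
- rewrite map_Fpol map_Gpol evC evX /Fpol /Gpol.
  by rewrite (eq_Fval ext') (eq_Gval ext').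
- by rewrite rmorphXn rmorph_nat expf_neq0.
- by rewrite rmorphM rmorphN rmorphXn rmorph_nat evC mulf_neq0 ?oppr_eq0 ?expf_neq0.
Qed.

Lemma Eres_resultant : s != 0 ->
  (map_poly phi Eres).[s] = resultant (Hpol (phi zu2) s (phi \o zsigma))
                                      (Kpol (phi zu2) s (phi \o zsigma)).
Proof.
move=> s0.
have [|_ lH] := has_top_lead _ (top_Hpol zu2%:P 'X (polyC \o zsigma)).
  by rewrite expf_neq0.
have [|_ lK] := has_top_lead _ (top_Kpol zu2%:P 'X (polyC \o zsigma)).
  by rewrite mulf_neq0 ?polyX_eq0 ?oppr_eq0 ?expf_neq0.
rewrite -[LHS]/(ev Eres) /Eres resultant_map ?lH ?lK.
- rewrite map_Hpol map_Kpol evC evX /Hpol /Kpol.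
  by rewrite (eq_Hval ext') (eq_Kval ext').
- by rewrite rmorphXn rmorph_nat expf_neq0.
- by rewrite rmorphM rmorphN rmorphXn rmorph_nat evX mulf_neq0 ?oppr_eq0 ?expf_neq0.
Qed.

End DresIdomain.

Section DresClosed.
Variables (K : closedFieldType) (u s : K) (e : nat -> K).
Hypothesis char0 : forall k, k.+1%:R != 0 :> K.
Hypotheses (u0 : u != 0) (s0 : s != 0) (s2 : s ^+ 2 = - (u * e 6%N)).

Let c : K := - 96%:R ^+ 2 * u.
Let c0 : c != 0.
Proof. by rewrite mulf_neq0 ?oppr_eq0 ?expf_neq0. Qed.

Lemma Gpol_roots : exists rs : seq K,
  size rs = 5 /\ Gpol u s e = c *: \prod_(b <- rs) ('X - b%:P).
Proof.
have [rs GE] := closed_field_poly_normal (Gpol u s e).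
have [sG lG] := has_top_lead c0 (top_Gpol u s e).
exists rs; rewrite -[c]lG; split=> //.
by have := sG; rewrite GE size_scale ?lG // size_prod_XsubC => -[].
Qed.

Lemma resultant_FG rs : Gpol u s e = c *: \prod_(b <- rs) ('X - b%:P) ->
  resultant (Fpol u s e) (Gpol u s e) = c ^+ 6 * \prod_(b <- rs) Fval b u s e.
Proof.
move=> ->; have [|sF _] := has_top_lead _ (top_Fpol u s e).
  by rewrite expf_neq0.
rewrite resultant_roots // ?sF /=; last by rewrite -size_poly_eq0 sF.
by congr (_ * _); apply: eq_bigr => b _; rewrite horner_Fpol.
Qed.

(* At a root of G one has u T5 = 8 s T3, and s^2 = u t6 turns T3^2 into (u / 64 t6) T5^2; so F = (u / 64 t6) H there. *)
Lemma resultant_FG_HK :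
  64%:R ^+ 5 * 96%:R ^+ 8 * e 6%N ^+ 10 * resultant (Fpol u s e) (Gpol u s e) =
  u ^+ 6 * resultant (Hpol u s e) (Kpol u s e).
Proof.
have [rs [srs GE]] := Gpol_roots; rewrite (resultant_FG GE).
have e6 : e 6%N = - (s ^+ 2 / u) by rewrite s2 mulNr opprK mulrAC divff ?mul1r.
pose d : K := - 96%:R ^+ 2 * s.
have d0 : d != 0 by rewrite mulf_neq0 ?oppr_eq0 ?expf_neq0.
have KG : Kpol u s e = d *: \prod_(b <- rs) ('X - b%:P).
  (* As s^2 = - u e_6, K is proportional to G and has the same roots with the same
     multiplicities. *)
  have -> : Kpol u s e = (s / u) *: Gpol u s e.
    rewrite -mul_polyC /Kpol /Gpol /Kval /Gval.
    have -> : (polyC \o e) 6%N = - ((s / u)%:P * s%:P).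
      by rewrite /= e6 polyCN -polyCM mulrAC.
    have -> : s%:P * T5 'X u%:P (polyC \o e) =
        (s / u)%:P * u%:P * T5 'X u%:P (polyC \o e).
      by rewrite -polyCM divfK.
    by ring.
  by rewrite GE scalerA /c /d mulrCA divfK // .
rewrite KG.
have [|sH _] := has_top_lead _ (top_Hpol u s e).
  by rewrite expf_neq0.
rewrite resultant_roots // ?sH /=; last by rewrite -size_poly_eq0 sH.
have -> : \prod_(b <- rs) (Hpol u s e).[b] = \prod_(b <- rs) Hval b u s e.
  by apply: eq_bigr => b _; rewrite horner_Hpol.
have FH : \prod_(b <- rs) (- 64%:R * e 6%N * Fval b u s e) =
    \prod_(b <- rs) (u * Hval b u s e).
  apply: eq_big_seq => b brs.
  have /eqP : (Gpol u s e).[b] = 0.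
    by apply/eqP; rewrite -rootE GE rootZ // root_prod_XsubC.
  rewrite horner_Gpol /Gval subr_eq0 => /eqP Gb.
  have {}Gb : T5 b u e = 8 * s * T3 b u e / u by rewrite -Gb mulrAC divff ?mul1r.
  rewrite /Fval /Hval Gb e6.
  by field.
move: FH; rewrite !big_split /= !big_const_seq !count_predT srs.
set P := \prod_(b <- rs) _; set Q := \prod_(b <- rs) _.
rewrite /= !mulr1 => FH.
(* The leading coefficient of K enters with exponent deg H = 10; its s^10 supplies the remaining
   powers of u and e_6. *)
have s10 : s ^+ 10 = - (u * e 6%N) ^+ 5 by rewrite (exprM s 2 5) s2; ring.
rewrite /c /d; move: FH s10; move: (96%:R) (64%:R) => n96 n64 FH s10.
have {}FH : (- n64) ^+ 5 * e 6%N ^+ 5 * P = u ^+ 5 * Q.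
  by apply: etrans (etrans FH _); ring.
transitivity (- n96 ^+ 20 * u ^+ 6 * e 6%N ^+ 5 *
   ((- n64) ^+ 5 * e 6%N ^+ 5 * P)); first by ring.
rewrite FH.
transitivity (u ^+ 6 * n96 ^+ 20 * (- (u * e 6%N) ^+ 5) * Q); first by ring.
by rewrite -s10; ring.
Qed.

End DresClosed.

(** * Behaviour under dilation and one explicit value *)

Section Weights.
Variable A : comNzRingType.
Implicit Types (x u s : A) (e : nat -> A).

(** Squared lengths have weight 1: r^2 has weight 1, sigma_k weight k, u_2 weight 2, and s weight 4
    because s^2 = - u_2 sigma_6. *)
Definition dilate (l : A) e : nat -> A := fun k => l ^+ k * e k.

Lemma Fval_dilate l x u s e :
  Fval (l * x) (l ^+ 2 * u) (l ^+ 4 * s) (dilate l e) = l ^+ 6 * Fval x u s e.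
Proof. by rewrite /Fval /T3 /T4 /T2 /T1 /dilate; ring. Qed.

Lemma Gval_dilate l x u s e :
  Gval (l * x) (l ^+ 2 * u) (l ^+ 4 * s) (dilate l e) = l ^+ 7 * Gval x u s e.
Proof. by rewrite /Gval /T3 /T5 /T2 /T1 /dilate; ring. Qed.

End Weights.

Lemma Gpol_dilate (K : fieldType) (l u s : K) (e : nat -> K) c (rs : seq K) :
  l != 0 -> size rs = 5 ->
  Gpol u s e = c *: \prod_(b <- rs) ('X - b%:P) ->
  Gpol (l ^+ 2 * u) (l ^+ 4 * s) (dilate l e) =
  (l ^+ 2 * c) *: \prod_(b <- [seq l * b | b <- rs]) ('X - b%:P).
Proof.
move=> l0 srs GE; pose y : {poly K} := (l^-1)%:P * 'X.
have yE : l%:P * y = 'X by rewrite mulrA -polyCM divff ?mul1r.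
have Gy : Gval y u%:P s%:P (polyC \o e) = c%:P * \prod_(b <- rs) (y - b%:P).
  have := congr1 (comp_poly y) GE; rewrite morph_Gval /= comp_polyX !comp_polyC.
  have ext : comp_poly y \o (polyC \o e) =1 polyC \o e by move=> k; apply: comp_polyC.
  rewrite (eq_Gval ext) => ->; rewrite comp_polyZ rmorph_prod /= mul_polyC.
  by congr (_ *: _); apply: eq_bigr => b _; rewrite comp_polyB comp_polyX comp_polyC.
have ext : polyC \o dilate l e =1 dilate l%:P (polyC \o e).
  by move=> k; rewrite /dilate /= polyCM rmorphXn.
have CX n x : (l ^+ n * x)%:P = l%:P ^+ n * x%:P by rewrite polyCM rmorphXn.
rewrite /Gpol (eq_Gval ext) -yE !CX Gval_dilate Gy.
rewrite big_map -!mul_polyC CX.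
rewrite [in RHS](eq_bigr (fun b => l%:P * (y - b%:P))) => [|b _]; last first.
  by rewrite mulrBr yE polyCM.
rewrite big_split /= big_const_seq count_predT srs /=.
by ring.
Qed.

Section DresClosedValues.
Variable K : closedFieldType.
Hypothesis char0 : forall k, k.+1%:R != 0 :> K.

(** 42 = 6 * 2 + 5 * 6: the leading coefficient of G scales by l^2 and enters to the sixth power,
    and F scales by l^6 at each of the five roots of G. *)
Lemma resultant_FG_dilate (l u s : K) (e : nat -> K) : u != 0 -> l != 0 ->
  resultant (Fpol (l ^+ 2 * u) (l ^+ 4 * s) (dilate l e))
            (Gpol (l ^+ 2 * u) (l ^+ 4 * s) (dilate l e)) =
  l ^+ 42 * resultant (Fpol u s e) (Gpol u s e).
Proof.
move=> u0 l0; have [rs [srs GE]] := Gpol_roots s e char0 u0.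
rewrite (resultant_FG char0 u0 GE).
have GE' := Gpol_dilate l0 srs GE.
have eqc : l ^+ 2 * (- 96 ^+ 2 * u) = - 96 ^+ 2 * (l ^+ 2 * u) by ring.
rewrite eqc in GE'; rewrite (resultant_FG char0 _ GE') ?mulf_neq0 ?expf_neq0 // big_map.
under eq_bigr do rewrite Fval_dilate.
rewrite big_split /= big_const_seq count_predT srs /=.
by ring.
Qed.

(** Here G is a multiple of x (x^2 + 1/12)^2, with roots 0 and, twice each, a and -a where 12 a^2 =
    -1. F equals -64 at 0 and 128^2 a^6 at the others, and 96^12 * 64 * 128^8 / 12^12 = 2^98. *)
Lemma resultant_FG_at_1_0 :
  resultant (Fpol 1 0 (fun=> 0 : K)) (Gpol 1 0 (fun=> 0 : K)) = - 2 ^+ 98.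
Proof.
have [a a2] : exists a : K, 12%:R * a ^+ 2 = -1.
  have [a] := solve_monicpoly (fun i => if i is 0 then - 12%:R^-1 else 0 : K) (isT : (0 < 2)%N).
  rewrite !big_ord_recl big_ord0 /= expr0 mulr1 mul0r !addr0 => a2.
  by exists a; rewrite a2 mulrN divff ?char0.
have GE : Gpol 1 0 (fun=> 0) =
    (- 96%:R ^+ 2 * 1) *: \prod_(b <- [:: 0; a; a; - a; - a]) ('X - b%:P).
  rewrite !big_cons big_nil /Gpol /Gval /T3 /T5 /T2 /T1 /= -mul_polyC.
  have -> : (- 96%:R ^+ 2 * 1)%:P = - 96%:R ^+ 2 :> {poly K}.
    by rewrite mulr1 polyCN rmorphXn rmorph_nat.
  rewrite polyC1 polyC0 polyCN.
  have a2P : 12%:R * a%:P ^+ 2 = -1 :> {poly K}.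
    by rewrite -polyC_exp -polyC_natr -polyCM a2 polyCN.
  have key : (0 - 4 * 'X) ^+ 2 - 4 * 0 + 16 * 'X * (0 - 4 * 'X) - 4 * 1 =
      - 48%:R * ('X ^+ 2 - a%:P ^+ 2) :> {poly K}.
    have -> : - 48%:R * ('X ^+ 2 - a%:P ^+ 2) =
      - 48%:R * 'X ^+ 2 + 4 * (12%:R * a%:P ^+ 2) :> {poly K} by ring.
    by rewrite a2P; ring.
  by rewrite key; ring.
have F0 : Fval 0 1 0 (fun=> 0) = - 64%:R :> K.
  by rewrite /Fval /T3 /T4 /T2 /T1; ring.
have Fa (b : K) : 12%:R * b ^+ 2 = -1 -> Fval b 1 0 (fun=> 0) = 128%:R ^+ 2 * b ^+ 6.
  move=> b2; rewrite /Fval /T3 /T4.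
  have -> : T2 b 1 (fun=> 0) = 0.
    by rewrite /T2 /T1; transitivity (- 4 * (12%:R * b ^+ 2) - 4); [ring | rewrite b2; ring].
  by rewrite /T1; ring.
rewrite (resultant_FG char0 _ GE) ?oner_eq0 // !big_cons big_nil F0.
rewrite !(Fa a a2) !(Fa (- a)) ?sqrrN //.
transitivity (- 2 ^+ 98 * (12%:R * a ^+ 2) ^+ 12); last by rewrite a2; ring.
have -> : 96%:R = 8%:R * 12%:R :> K by rewrite -natrM.
have -> : 128%:R = 2 ^+ 7 :> K by rewrite -natrX.
have -> : 64%:R = 2 ^+ 6 :> K by rewrite -natrX.
have -> : 8%:R = 2 ^+ 3 :> K by rewrite -natrX.
move: (12%:R) (2 : K) => n m.
by ring.
Qed.

End DresClosedValues.

(** * Elimination of the square root and divisibility by u_2^12 *)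

(** With p = E(X^2) + X O(X^2), the product p(x) p(-x) is E^2 - X O^2 at x^2. This gives the norm
    from s to s^2 without adjoining a square root. *)
Definition even_norm (A : comNzRingType) (p : {poly A}) : {poly A} :=
  even_poly p ^+ 2 - 'X * odd_poly p ^+ 2.

Lemma horner_even_norm (A B : comNzRingType) (f : {rmorphism A -> B}) p x :
  (map_poly f p).[x] * (map_poly f p).[- x] = (map_poly f (even_norm p)).[x ^+ 2].
Proof.
have hE y : (map_poly f p).[y] =
    (map_poly f (even_poly p)).[y ^+ 2] + (map_poly f (odd_poly p)).[y ^+ 2] * y.
  rewrite -{1}(poly_even_odd p) rmorphD rmorphM /= !map_comp_poly !map_polyXn map_polyX.
  by rewrite hornerD hornerM !horner_comp hornerXn hornerX.
rewrite !hE sqrrN /even_norm rmorphB rmorphXn rmorphM rmorphXn /= map_polyX.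
by rewrite hornerD horner_exp hornerN hornerM horner_exp hornerX; ring.
Qed.

Definition Znorm (p : {poly Zus}) : Zus := (even_norm p).[- (zu2 * zsigma 6)].

Lemma morph_Znorm (K : comNzRingType) (phi : {rmorphism Zus -> K}) s p :
  s ^+ 2 = - (phi zu2 * phi (zsigma 6)) ->
  phi (Znorm p) = (map_poly phi p).[s] * (map_poly phi p).[- s].
Proof.
by move=> s2; rewrite horner_even_norm s2 -rmorphM -rmorphN horner_map.
Qed.

(** Points with positive integer coordinates are Zariski dense. At the tested morphisms no variable
    vanishes, so u_2 and sigma_6 become invertible, and the values in [algC] have square roots. *)
Lemma mpoly_int_ext n (p q : mpoly n int) :
  (forall phi : {rmorphism mpoly n int -> algC},
     (forall i, phi (mpolyX int (mnm1 i)) != 0) -> phi p = phi q) -> p = q.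
Proof.
move=> pq; suff : map_mpoly (intr : int -> algC) (p - q) = 0.
  move=> h; apply/eqP; rewrite -subr_eq0; apply/eqP/mpolyP => m.
  have := congr1 (mcoeff m) h; rewrite mcoeff_map_mpoly !mcoeff0 => /eqP.
  by rewrite intr_eq0 => /eqP.
apply: (@mpoly_eq0_dense _ _ _ (fun _ k => k.+1%:R)) => [i j k /eqP|k].
  by rewrite eqr_nat eqSS => /eqP.
set v := (X in meval X).
have := pq (meval v \o map_mpoly (intr : int -> algC)); rewrite /= => {}pq.
rewrite rmorphB /= mevalB pq ?subrr // => i.
by rewrite map_mpolyX mevalXU pnatr_eq0.
Qed.

Lemma mcoeffMX0 n (R : nzRingType) (p : mpoly n R) (i : 'I_n) b (m : multinom n) :
  (m i < b)%N -> mcoeff m (p * mpolyX R (mnm_muln (mnm1 i) b)) = 0.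
Proof.
move=> mb; apply/eqP; rewrite mcoeff_eq0 (perm_mem (msuppMX _ _)).
apply: contraL mb => /mapP[m' _ ->].
by rewrite -leqNgt mnmDE mulmnE mnm1E eqxx mul1n leq_addr.
Qed.

(** Multiplication by X_j^a leaves the exponent of X_i unchanged, so p has no monomial whose degree
    in X_i is below b. *)
Lemma mpolyX_dvd n (R : idomainType) (c : R) (i j : 'I_n) a b (p q : mpoly n R) :
  c != 0 -> i != j ->
  mpolyC n c * (p * mpolyX R (mnm_muln (mnm1 j) a)) = q * mpolyX R (mnm_muln (mnm1 i) b) ->
  exists r, p = r * mpolyX R (mnm_muln (mnm1 i) b).
Proof.
rewrite mul_mpolyC => c0 ij pq.
have p0 (m : multinom n) : (m i < b)%N -> mcoeff m p = 0.
  move=> mb; apply: (mulfI c0); rewrite mulr0.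
  rewrite -(mcoeffMX p (mnm_muln (mnm1 j) a) m) -mcoeffZ pq mcoeffMX0 //.
  by rewrite mnmDE mulmnE mnm1E eq_sym (negbTE ij) mul0n.
pose B := mnm_muln (mnm1 i) b.
exists (\sum_(m <- msupp p) mcoeff m p *: mpolyX R (mnm_sub m B)).
rewrite mulr_suml [LHS]mpolyE big_seq [RHS]big_seq; apply: eq_bigr => m mp.
rewrite -scalerAl -mpolyXD submK //.
apply/mnm_lepP => k; rewrite mulmnE mnm1E; case: eqP => [<-|_] //.
rewrite mul1n leqNgt; apply/negP => /p0; apply/eqP.
by rewrite -mcoeff_msupp.
Qed.

Lemma algC_natr_neq0 k : k.+1%:R != 0 :> algC.
Proof. by rewrite pnatr_eq0. Qed.

Lemma norm_relation (A K : comNzRingType) (phi : {rmorphism A -> K})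
    (N M u e : A) (d d' m m' : K) :
  phi N = d * d' -> phi M = m * m' ->
  64%:R ^+ 5 * 96%:R ^+ 8 * phi e ^+ 10 * d = phi u ^+ 6 * m ->
  64%:R ^+ 5 * 96%:R ^+ 8 * phi e ^+ 10 * d' = phi u ^+ 6 * m' ->
  phi ((64%:R ^+ 5 * 96%:R ^+ 8) ^+ 2 * (N * e ^+ 20)) = phi (M * u ^+ 12).
Proof.
move=> NE ME R1 R2; rewrite !(rmorph_nat, rmorphXn, rmorphM) NE ME.
move: (64%:R) (96%:R) (phi u) (phi e) R1 R2 => a b p q R1 R2.
transitivity ((a ^+ 5 * b ^+ 8 * q ^+ 10 * d) * (a ^+ 5 * b ^+ 8 * q ^+ 10 * d')).
  by ring.
by rewrite R1 R2; ring.
Qed.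

Lemma Znorm_Dres_Eres :
  (64%:R ^+ 5 * 96%:R ^+ 8) ^+ 2 * (Znorm Dres * zsigma 6 ^+ 20) =
  Znorm Eres * zu2 ^+ 12.
Proof.
apply: mpoly_int_ext => phi phi0.
have u0 : phi zu2 != 0 := phi0 ord0.
have e0 : phi (zsigma 6) != 0 := phi0 (inord 6).
pose s := sqrtC (- (phi zu2 * phi (zsigma 6))).
have s2 : s ^+ 2 = - (phi zu2 * phi (zsigma 6)) by exact: sqrtCK.
have s0 : s != 0.
  by apply: contra_eq_neq s2 => ->; rewrite expr0n /= eq_sym oppr_eq0 mulf_neq0.
have s2' : (- s) ^+ 2 = - (phi zu2 * (phi \o zsigma) 6%N) by rewrite sqrrN.
have s0' : - s != 0 by rewrite oppr_eq0.
have R1 := @resultant_FG_HK _ _ _ (phi \o zsigma) algC_natr_neq0 u0 s0 s2.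
have R2 := @resultant_FG_HK _ _ _ (phi \o zsigma) algC_natr_neq0 u0 s0' s2'.
rewrite -(Dres_resultant _ algC_natr_neq0 u0) -(Eres_resultant phi algC_natr_neq0 s0) in R1.
rewrite -(Dres_resultant _ algC_natr_neq0 u0) -(Eres_resultant phi algC_natr_neq0 s0') in R2.
exact: (norm_relation (morph_Znorm Dres s2) (morph_Znorm Eres s2) R1 R2).
Qed.

Lemma exists_Pz : exists P : Zus, Znorm Dres = P * zu2 ^+ 12.
Proof.
have cE (a b : nat) : (a%:R ^+ 5 * b%:R ^+ 8) ^+ 2 =
    mpolyC 7 ((a%:R ^+ 5 * b%:R ^+ 8) ^+ 2) :> Zus.
  by rewrite !(rmorphXn, rmorphM) /= !mpolyC_nat.
have := Znorm_Dres_Eres; rewrite cE.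
have c0 : (64%:R ^+ 5 * 96%:R ^+ 8) ^+ 2 != 0 :> int.
  by apply: expf_neq0; apply: mulf_neq0; apply: expf_neq0; rewrite pnatr_eq0.
move: (_ ^+ 2) c0 => c c0; move: (Znorm Dres) (Znorm Eres) => N M.
rewrite /zu2 /zsigma !mpolyXn => NM.
have [|] := mpolyX_dvd c0 _ NM; last by move=> P; exists P.
by rewrite -val_eqE /= inordK.
Qed.

(** Only the indices 1 to 6 are read. The restriction matters because [zsigma 0] is [zu2], which has
    weight 2 and not 0. *)
Lemma eq_in_Fpol (R : comNzRingType) (u s : R) (e e' : nat -> R) :
  (forall k, (0 < k < 7)%N -> e k = e' k) -> Fpol u s e = Fpol u s e'.
Proof. by move=> ee'; rewrite /Fpol /Fval /T3 /T4 /T2 /T1 /= !ee'. Qed.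

Lemma eq_in_Gpol (R : comNzRingType) (u s : R) (e e' : nat -> R) :
  (forall k, (0 < k < 7)%N -> e k = e' k) -> Gpol u s e = Gpol u s e'.
Proof. by move=> ee'; rewrite /Gpol /Gval /T3 /T5 /T2 /T1 /= !ee'. Qed.

(** * Weight and leading coefficient of the quotient P *)

Definition wt (m : multinom 7) : nat := (\sum_(i < 7) (if i == ord0 then 2 else i) * m i)%N.

Definition dilation (i : 'I_7) : int := 2 ^+ (if i == ord0 then 2%N else i).

(** The single dilation by 2 detects weights, since distinct powers of 2 are distinct integers. *)
Definition Zdilate : {rmorphism Zus -> Zus} :=
  comp_mpoly [tuple mpolyC 7 (dilation i) * mpolyX int (mnm1 i) | i < 7].

Lemma ZdilateX i : Zdilate (mpolyX int (mnm1 i)) = mpolyC 7 (dilation i) * mpolyX int (mnm1 i).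
Proof. by rewrite /= comp_mpolyXU -tnth_nth tnth_mktuple. Qed.

Lemma mcoeff_Zdilate (p : Zus) m : mcoeff m (Zdilate p) = 2 ^+ wt m * mcoeff m p.
Proof.
rewrite /= comp_mpolyEX raddf_sum [in RHS](mpolyE p) raddf_sum mulr_sumr /=.
apply: eq_bigr => k _; rewrite !mcoeffZ comp_mpolyX.
have -> : \prod_(i < 7)
     tnth [tuple mpolyC 7 (dilation i0) * mpolyX int (mnm1 i0) | i0 < 7] i ^+ k i =
     mpolyC 7 (2 ^+ wt k) * mpolyX int k.
  under eq_bigr do rewrite tnth_mktuple exprMn -rmorphXn.
  rewrite big_split /= -rmorph_prod mpolyXE_id; congr (mpolyC _ _ * _).
  under eq_bigr do rewrite /dilation -exprM.
  by rewrite -expr_sum.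
rewrite mcoeffCM mcoeffX; case: eqP => [->|_]; last by rewrite !mulr0.
by rewrite mulrCA mulrA.
Qed.

Lemma phi_exp2 (K : comNzRingType) (phi : {rmorphism Zus -> K}) k :
  phi (mpolyC 7 (2 ^+ k)) = 2 ^+ k.
Proof. by have := rmorphXn (phi \o @mpolyC 7 int) k 2; rewrite rmorph_nat. Qed.

Lemma phi_Zdilate (K : comNzRingType) (phi : {rmorphism Zus -> K}) i :
  phi (Zdilate (mpolyX int (mnm1 i))) =
  2 ^+ (if i == ord0 then 2%N else i) * phi (mpolyX int (mnm1 i)).
Proof.
by rewrite ZdilateX rmorphM; congr (_ * _); apply: phi_exp2.
Qed.

Lemma phi_Zdilate_sigma (K : comNzRingType) (phi : {rmorphism Zus -> K}) k :
  (0 < k < 7)%N -> phi (Zdilate (zsigma k)) = 2 ^+ k * phi (zsigma k).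
Proof.
case/andP=> k0 k7; rewrite /zsigma phi_Zdilate -val_eqE /= inordK //.
by rewrite eqn0Ngt k0.
Qed.

Lemma phi_Zdilate_u2 (K : comNzRingType) (phi : {rmorphism Zus -> K}) :
  phi (Zdilate zu2) = 2 ^+ 2 * phi zu2.
Proof. by rewrite /zu2 phi_Zdilate eqxx. Qed.

Lemma Dres_dilate (phi phi' : {rmorphism Zus -> algC}) (s : algC) :
  phi zu2 != 0 -> phi' zu2 = 2 ^+ 2 * phi zu2 ->
  (forall k, (0 < k < 7)%N -> phi' (zsigma k) = 2 ^+ k * phi (zsigma k)) ->
  (map_poly phi' Dres).[2 ^+ 4 * s] = 2 ^+ 42 * (map_poly phi Dres).[s].
Proof.
move=> u0 e1 e2; have two0 : 2 != 0 :> algC by rewrite pnatr_eq0.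
have {}e2 k : (0 < k < 7)%N -> (phi' \o zsigma) k = dilate 2 (phi \o zsigma) k.
  exact: e2.
rewrite !Dres_resultant ?e1 ?mulf_neq0 ?expf_neq0 //; try exact: algC_natr_neq0.
rewrite (eq_in_Fpol _ _ e2) (eq_in_Gpol _ _ e2).
exact: (resultant_FG_dilate algC_natr_neq0 s (phi \o zsigma) u0 two0).
Qed.

(** Count of weights: 42 for each of D(s) and D(-s), minus 24 for u_2^12, leaves 60. *)
Lemma dilation_relation (A : comNzRingType) (K : idomainType)
    (phi phi' : {rmorphism A -> K}) (N P u : A) (d d' : K) :
  2 != 0 :> K -> phi u != 0 -> N = P * u ^+ 12 -> phi' u = 2 ^+ 2 * phi u ->
  phi N = d * d' -> phi' N = (2 ^+ 42 * d) * (2 ^+ 42 * d') ->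
  phi' P = 2 ^+ 60 * phi P.
Proof.
move=> two0 u0 -> e1; rewrite !(rmorphM, rmorphXn) e1 => e2 e3.
have cu : 2 ^+ 24 * phi u ^+ 12 != 0 by rewrite mulf_neq0 ?expf_neq0.
apply: (mulIf cu); move: e3; rewrite -mulrACA -e2.
move: (2 : K) (phi u) (phi P) (phi' P) => t v p p' e3.
transitivity (p' * (t ^+ 2 * v) ^+ 12); first by ring.
by rewrite e3; ring.
Qed.

Section Quotient.
Variable P : Zus.
Hypothesis PE : Znorm Dres = P * zu2 ^+ 12.

Lemma P_dilate : Zdilate P = mpolyC 7 (2 ^+ 60) * P.
Proof.
apply: mpoly_int_ext => phi phi0.
have u0 : phi zu2 != 0 := phi0 ord0.
have two0 : 2 != 0 :> algC by rewrite pnatr_eq0.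
pose s := sqrtC (- (phi zu2 * phi (zsigma 6))).
have s2 : s ^+ 2 = - (phi zu2 * phi (zsigma 6)) by exact: sqrtCK.
pose phi' : {rmorphism Zus -> algC} := phi \o Zdilate.
have e1 : phi' zu2 = 2 ^+ 2 * phi zu2 := phi_Zdilate_u2 phi.
have e2 k : (0 < k < 7)%N -> phi' (zsigma k) = 2 ^+ k * phi (zsigma k).
  exact: phi_Zdilate_sigma.
have s2' : (2 ^+ 4 * s) ^+ 2 = - (phi' zu2 * phi' (zsigma 6)).
  by rewrite e1 e2 // exprMn s2; ring.
have N1 := morph_Znorm Dres s2; have N2 := morph_Znorm Dres s2'.
rewrite -mulrN !(Dres_dilate _ u0 e1 e2) // in N2.
rewrite (_ : phi (mpolyC 7 (2 ^+ 60) * P) = 2 ^+ 60 * phi P).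
  exact: (dilation_relation two0 u0 PE e1 N1 N2).
have phiE k p : phi (mpolyC 7 (2 ^+ k) * p) = 2 ^+ k * phi p.
  by rewrite rmorphM phi_exp2.
exact: phiE.
Qed.

Lemma P_weight m : m \in msupp P -> wt m = 60.
Proof.
rewrite mcoeff_msupp => Pm; have := congr1 (mcoeff m) P_dilate.
rewrite mcoeff_Zdilate mcoeffCM => /(mulIf Pm) => e.
by have := @ieexprIn _ (2 : int) isT isT _ _ e.
Qed.

(** With sigma_6 = 0 the square root is s = 0, so N = D(0)^2 = (-2^98)^2. *)
Lemma P_at_1_0 (phi : {rmorphism Zus -> algC}) :
  phi zu2 = 1 -> (forall k, (0 < k < 7)%N -> phi (zsigma k) = 0) ->
  phi P = 2 ^+ 196.
Proof.
move=> u1 sig0; have s2 : 0 ^+ 2 = - (phi zu2 * phi (zsigma 6)).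
  by rewrite sig0 // mulr0 oppr0 expr0n.
have := morph_Znorm Dres s2; rewrite PE oppr0 Dres_resultant ?u1 ?oner_eq0 //;
  last exact: algC_natr_neq0.
have e2 k : (0 < k < 7)%N -> (phi \o zsigma) k = 0 by exact: sig0.
rewrite (eq_in_Fpol _ _ e2) (eq_in_Gpol _ _ e2).
rewrite (resultant_FG_at_1_0 algC_natr_neq0).
have phiE (p q : Zus) k : phi (p * q ^+ k) = phi p * phi q ^+ k.
  by rewrite rmorphM rmorphXn.
rewrite phiE u1 expr1n mulr1 => ->.
by rewrite mulrNN -exprD.
Qed.

End Quotient.

Section UHom.
Variables (R : comNzRingType) (e : nat -> R).

Definition uvar (i : 'I_7) : {poly R} := if i == ord0 then 'X else (e i)%:P.

(** Keeps u_2 as the variable and gives sigma_k the value [e k]: integers for irreducibility,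
    elementary symmetric polynomials for divisibility. *)
Definition uhom : {rmorphism Zus -> {poly R}} := mmap (polyC \o (intr : int -> R)) uvar.

Lemma uhom_u2 : uhom zu2 = 'X.
Proof. by rewrite /uhom /= /zu2 mmapX mmap1U /uvar eqxx. Qed.

Lemma uhom_sigma k : (0 < k < 7)%N -> uhom (zsigma k) = (e k)%:P.
Proof.
case/andP=> k0 k7; rewrite /uhom /= /zsigma mmapX mmap1U /uvar -val_eqE /= inordK //.
by rewrite eqn0Ngt k0.
Qed.

Lemma mmap1_uvar (m : multinom 7) :
  mmap1 uvar m = (\prod_(i < 6) e i.+1 ^+ m (lift ord0 i))%:P * 'X^(m ord0).
Proof.
rewrite /mmap1 big_ord_recl /= /uvar eqxx mulrC rmorph_prod; congr (_ * _).
by apply: eq_bigr => i _; rewrite rmorphXn.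
Qed.

Lemma size_uhom (Q : Zus) n :
  (forall m, m \in msupp Q -> (m ord0 < n)%N) -> (size (uhom Q) <= n)%N.
Proof.
move=> Qn; rewrite /uhom /= /mmap big_seq.
apply: (leq_trans (size_sum _ _ _)); apply/bigmax_leqP_seq => m _ /Qn mn.
rewrite mmap1_uvar /= mulrA -polyCM mul_polyC.
by rewrite (leq_trans (size_scale_leq _ _)) // size_polyXn.
Qed.

End UHom.

Lemma wt_recl (m : multinom 7) :
  wt m = (2 * m ord0 + \sum_(i < 6) i.+1 * m (lift ord0 i))%N.
Proof. by rewrite /wt big_ord_recl. Qed.

Lemma wt60_le (m : multinom 7) : wt m = 60 -> (m ord0 <= 30)%N.
Proof. by rewrite wt_recl; lia. Qed.

Lemma wt60_eq (m : multinom 7) : wt m = 60 ->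
  (m ord0 == 30) = (m == mnm_muln (mnm1 ord0) 30).
Proof.
move=> wm; apply/eqP/eqP => [m0|->]; last by rewrite mulmnE mnm1E eqxx mul1n.
move: wm; rewrite wt_recl m0 => /eqP.
rewrite -[X in _ == X]addn0 eqn_add2l sum_nat_eq0 => /forallP /= mi.
apply/mnmP => i; rewrite mulmnE mnm1E.
have [j ->|->] := unliftP ord0 i; last by rewrite eqxx m0.
by have := mi j; rewrite muln_eq0 /= => /eqP ->.
Qed.

Section QuotientTop.
Variable P : Zus.
Hypothesis PE : Znorm Dres = P * zu2 ^+ 12.

Let top := mnm_muln (mnm1 (ord0 : 'I_7)) 30.

(** By homogeneity a monomial of P without any sigma_k is u_2^30, so the value at u_2 = 1, sigma_k =
    0 is this coefficient. *)
Lemma mcoeff_P_top : mcoeff top P = 2 ^+ 196.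
Proof.
pose v (i : 'I_7) : algC := (i == ord0)%:R.
pose phi : {rmorphism Zus -> algC} := meval v \o map_mpoly (intr : int -> algC).
have phiX i : phi (mpolyX int (mnm1 i)) = v i.
  by rewrite /phi /= map_mpolyX mevalXU.
have phiu : phi zu2 = 1 by rewrite /zu2 phiX /v eqxx.
have phis k : (0 < k < 7)%N -> phi (zsigma k) = 0.
  move=> /andP[k0 k7]; rewrite /zsigma phiX /v -val_eqE /= inordK //.
  by rewrite eqn0Ngt k0.
have := P_at_1_0 PE phiu phis.
have -> : phi P = (mcoeff top P)%:~R.
  rewrite {1}(mpolyE P) rmorph_sum /= [in RHS](mpolyE P) [in RHS]raddf_sum /=.
  rewrite rmorph_sum /= big_seq [RHS]big_seq; apply: eq_bigr => m mP.
  rewrite map_mpolyZ mevalZ map_mpolyX mevalX mcoeffZ mcoeffX rmorphM /=.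
  congr (_ * _); rewrite big_ord_recl /v eqxx expr1n mul1r.
  have wm := P_weight PE mP; rewrite -(wt60_eq wm).
  have := wm; rewrite wt_recl => wm'.
  case: eqP => [m0|m0].
    rewrite big1 // => i _; have := wt60_eq wm; rewrite m0 eqxx => /esym/eqP ->.
    by rewrite mulmnE mnm1E.
  have [i mi] : exists i : 'I_6, m (lift ord0 i) != 0%N.
    apply/existsP; rewrite -[X in is_true X]negbK negb_exists.
    apply/negP => /forallP /= mi0; apply: m0.
    move: wm'; rewrite big1; first by lia.
    by move=> i _; have := mi0 i; rewrite negbK => /eqP ->; rewrite muln0.
  by rewrite (bigD1 i) //= expr0n (negbTE mi) mul0r.
move=> e; apply: (@intr_inj algC); rewrite /= e rmorphXn.
by congr (_ ^+ _).
Qed.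

Lemma P_split : exists2 Q : Zus,
  P = mpolyC 7 (2 ^+ 196) * zu2 ^+ 30 + Q &
  forall m, m \in msupp Q -> (m ord0 < 30)%N.
Proof.
exists (P - mpolyC 7 (2 ^+ 196) * zu2 ^+ 30); first by rewrite addrCA subrr addr0.
move=> m; rewrite mcoeff_msupp mcoeffB mcoeffCM /zu2 mpolyXn mcoeffX -/top.
case: (top =P m) => [<-|topm]; first by rewrite mcoeff_P_top mulr1 subrr eqxx.
rewrite mulr0 subr0 -mcoeff_msupp => /(P_weight PE) wm.
by rewrite ltn_neqAle wt60_le // andbT wt60_eq // eq_sym; apply/eqP.
Qed.

Lemma top_uhom_P (R : comNzRingType) (e : nat -> R) :
  has_top 30 (2%:R ^+ 196) (uhom e P).
Proof.
have [Q -> Qm] := P_split; have sQ := size_uhom e Qm.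
rewrite rmorphD.
have -> : uhom e (mpolyC 7 (2 ^+ 196) * zu2 ^+ 30) = (2%:R ^+ 196) *: 'X^30.
  have phiE (A : comNzRingType) (phi : {rmorphism Zus -> A}) k q n :
    phi (mpolyC 7 (2 ^+ k) * q ^+ n) = 2 ^+ k * phi q ^+ n.
    by rewrite rmorphM phi_exp2 rmorphXn.
  by rewrite phiE uhom_u2 -mul_polyC polyC_exp polyC_natr.
split.
  rewrite (leq_trans (size_polyD _ _)) // geq_max (leq_trans sQ) //.
  by rewrite (leq_trans (size_scale_leq _ _)) // size_polyXn.
by rewrite coefD coefZ coefXn eqxx mulr1 nth_default ?addr0.
Qed.

End QuotientTop.

(** * Arithmetic of F_31[X] / (X^30 - 3) on coefficient lists *)

Definition ladd_rec := fix ladd (l l' : seq nat) {struct l} : seq nat :=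
  match l, l' with
  | c :: l, c' :: l' => ((c + c') %% 31)%N :: ladd l l'
  | [::], _ => l'
  | _, [::] => l
  end.
Definition ladd := ladd_rec.
Definition lscale c (l : seq nat) : seq nat := [seq ((c * x) %% 31)%N | x <- l].
Definition lsub l l' := ladd l (lscale 30 l').
(** Multiplication by theta: in a list of 30 entries the last one would belong to theta^30 = 3, so
    it returns, multiplied by 3, as the constant term. *)
Definition lshift30 (l : seq nat) : seq nat :=
  if size l == 30 then ((3 * last 0 l) %% 31)%N :: take 29 l else 0%N :: l.
Definition lmul (l l' : seq nat) : seq nat :=
  foldr (fun c acc => ladd (lscale c l') (lshift30 acc)) [::] l.
(** Horner value of a list. The laws below hold in every commutative ring with 31 = 0 and t^30 = 3,
    so a computation on lists transfers to any extension of F_31 containing such a t. *)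
Definition leval (A : nzSemiRingType) (t : A) (l : seq nat) : A :=
  foldr (fun c a => c%:R + t * a) 0 l.

Section ListEval.
Variables (A : comNzRingType) (t : A).
Hypotheses (char31 : 31%:R = 0 :> A) (t30 : t ^+ 30 = 3).

Let natr_mod n : (n %% 31)%:R = n%:R :> A.
Proof. by rewrite [in RHS](divn_eq n 31) natrD natrM char31 mulr0 add0r. Qed.

Lemma leval_add l l' : leval t (ladd l l') = leval t l + leval t l'.
Proof.
elim: l l' => [|c l IH] [|c' l'] /=; rewrite ?add0r ?addr0 //.
by rewrite IH natr_mod natrD; ring.
Qed.

Lemma leval_scale c l : leval t (lscale c l) = c%:R * leval t l.
Proof.
elim: l => [|x l IH] /=; first by rewrite mulr0.
by rewrite IH natr_mod natrM; ring.
Qed.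

Lemma leval_sub l l' : leval t (lsub l l') = leval t l - leval t l'.
Proof.
rewrite leval_add leval_scale (_ : 30%:R = -1 :> A) ?mulN1r //.
by apply/eqP; rewrite -addr_eq0 -(natrD _ 30 1) char31.
Qed.

Lemma leval_cat l l' : leval t (l ++ l') = leval t l + t ^+ size l * leval t l'.
Proof.
elim: l => [|x l IH] /=; first by rewrite mul1r add0r.
by rewrite IH exprS; ring.
Qed.

Lemma leval_shift l : leval t (lshift30 l) = t * leval t l.
Proof.
rewrite /lshift30; case: eqP => [sl|_] /=; last by rewrite add0r.
rewrite -{3}(cat_take_drop 29 l) leval_cat size_take sl natr_mod natrM /=.
have [x dx] : exists x, drop 29 l = [:: x].
  have := size_drop 29 l; rewrite sl.
  by case: (drop 29 l) => [|x [|]] // _; exists x.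
have -> : last 0%N l = x by rewrite -(cat_take_drop 29 l) dx last_cat.
by rewrite dx /= -t30; ring.
Qed.

Lemma leval_mul l l' : leval t (lmul l l') = leval t l * leval t l'.
Proof.
elim: l => [|c l IH] /=; first by rewrite mul0r.
by rewrite leval_add leval_scale leval_shift IH; ring.
Qed.

Lemma leval_const c : leval t [:: c] = c%:R.
Proof. by rewrite /= mulr0 addr0. Qed.

Lemma leval0 l : all (eq_op^~ 0%N) l -> leval t l = 0.
Proof.
elim: l => [|c l IH] //= /andP[/eqP -> /IH ->].
by rewrite mulr0 addr0.
Qed.

End ListEval.

Section ListElimination.
Variables (x u s : seq nat) (c1 c2 c3 c4 c5 : nat).

Let lT1 := lsub [:: c1] (lscale 4 x).
Let lT2 := lsub (ladd (lsub (lmul lT1 lT1) (lscale 4 [:: c2]))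
  (lmul (lscale 16 x) lT1)) (lscale 4 u).
Let lT3 := lsub (ladd (lscale 8 [:: c3]) (lmul lT1 lT2))
  (lmul (lscale 8 x) (lsub (lmul lT1 lT1) lT2)).
Let lT4 := lsub (lsub (lmul lT2 lT2) (lscale 64 [:: c4]))
  (lmul (lmul (lscale 32 x) lT1) lT2).
Let lT5 := lsub (lscale 64 [:: c5]) (lmul (lscale 4 x) (lmul lT2 lT2)).
Definition lFval := lsub (lmul lT3 lT3) (lmul (lscale 4 u) (lsub lT4 (lscale 128 s))).
Definition lGval := lsub (lmul u lT5) (lmul (lscale 8 s) lT3).

Variables (A : comNzRingType) (t : A) (e : nat -> A).
Hypotheses (char31 : 31%:R = 0 :> A) (t30 : t ^+ 30 = 3).
Hypotheses (e1 : e 1%N = c1%:R) (e2 : e 2%N = c2%:R) (e3 : e 3%N = c3%:R)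
  (e4 : e 4%N = c4%:R) (e5 : e 5%N = c5%:R).

Let simp := (leval_sub t char31, leval_add t char31, leval_mul char31 t30,
  leval_scale t char31, leval_const).

Let lT1E : leval t lT1 = T1 (leval t x) e.
Proof. by rewrite !simp /T1 e1. Qed.
Let lT2E : leval t lT2 = T2 (leval t x) (leval t u) e.
Proof. by rewrite !(simp, lT1E) /T2 e2 expr2. Qed.
Let lT3E : leval t lT3 = T3 (leval t x) (leval t u) e.
Proof. by rewrite !(simp, lT1E, lT2E) /T3 e3 expr2. Qed.
Let lT4E : leval t lT4 = T4 (leval t x) (leval t u) e.
Proof. by rewrite !(simp, lT1E, lT2E) /T4 e4 expr2. Qed.
Let lT5E : leval t lT5 = T5 (leval t x) (leval t u) e.
Proof. by rewrite !(simp, lT1E, lT2E) /T5 e5 expr2. Qed.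

Lemma leval_Fval : leval t lFval = Fval (leval t x) (leval t u) (leval t s) e.
Proof. by rewrite !(simp, lT3E, lT4E) /Fval expr2. Qed.
Lemma leval_Gval : leval t lGval = Gval (leval t x) (leval t u) (leval t s) e.
Proof. by rewrite !(simp, lT3E, lT5E) /Gval. Qed.

End ListElimination.

(* With theta^30 = 3, the polynomials in theta with coefficient lists cert_u, cert_s and cert_x are the values of u_2, s and r^2 at a common root of F and G over F_31, for sigma_k = cert_sigma k; found by computer search. *)
Definition cert_u : seq nat := [:: 27; 3; 22; 17; 21; 22; 17; 29; 18; 29; 26; 20; 10; 5; 25; 0; 24; 6; 18; 2; 2; 6; 23; 5; 4; 9; 7; 4; 21; 27]%N.
Definition cert_s : seq nat := [:: 0; 18; 2; 0; 25; 26; 10; 8; 9; 25; 13; 8; 3; 28; 21; 27; 9; 15; 27; 26; 20; 10; 21; 27; 13; 11; 8; 9; 8; 29]%N.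
Definition cert_x : seq nat := [:: 20; 18; 16; 16; 4; 12; 20; 1; 26; 24; 10; 3; 18; 26; 18; 19; 22; 5; 8; 30; 12; 20; 26; 14; 21; 28; 4; 20; 18; 1]%N.
Definition cert_sigma (k : nat) : nat := nth 0%N [:: 0; 26; 29; 0; 20; 17; 14]%N k.

(** F involves sigma_1 to sigma_4 only, G only sigma_1, sigma_2, sigma_3 and sigma_5; the numerals
    are these values. The 14 in [cert_s2] is sigma_6, in s^2 + sigma_6 u_2 = 0. *)
Lemma cert_F : all (eq_op^~ 0%N) (lFval cert_x cert_u cert_s 26 29 0 20).
Proof. by vm_compute. Qed.
Lemma cert_G : all (eq_op^~ 0%N) (lGval cert_x cert_u cert_s 26 29 0 17).
Proof. by vm_compute. Qed.
Lemma cert_s2 : all (eq_op^~ 0%N) (ladd (lmul cert_s cert_s) (lscale 14 cert_u)).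
Proof. by vm_compute. Qed.

Lemma leval_morph (A B : nzSemiRingType) (f : {rmorphism A -> B}) t l :
  f (leval t l) = leval (f t) l.
Proof.
elim: l => [|c l IH] /=; first by rewrite rmorph0.
by rewrite rmorphD rmorphM rmorph_nat IH.
Qed.

Lemma coef_leval (A : comNzRingType) (c : A) l n :
  (leval (c *: 'X) l)`_n = (nth 0%N l n)%:R * c ^+ n.
Proof.
elim: l n => [|x l IH] [|n] /=; rewrite ?coef0 ?nth_nil ?mul0r //.
  by rewrite coefD -polyC_natr coefC -scalerAl coefZ coefXM mulr0 addr0 mulr1.
rewrite coefD -polyC_natr coefC -scalerAl coefZ coefXM /= add0r IH exprS.
by rewrite mulrCA.
Qed.

Lemma size_leval (A : comNzRingType) (c : A) l : (size (leval (c *: 'X) l) <= size l)%N.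
Proof.
apply/leq_sizeP => j lj; rewrite coef_leval nth_default //.
by rewrite mul0r.
Qed.

(** 3 is a primitive root modulo 31: its first thirty powers, as a trajectory of natural numbers,
    are found distinct by computation. *)
Lemma pow3_inj : {in gtn 30%N &, injective (fun k => 3%:R ^+ k : 'F_31)}.
Proof.
pose f x := ((3 * x) %% 31)%N.
have powE k : 3%:R ^+ k = (iter k f 1%N)%:R :> 'F_31.
  elim: k => // k IH; rewrite exprS IH /= /f -natrM.
  by apply/val_inj; rewrite /= !val_Fp_nat // modn_mod.
have lt31 k : (k < 30)%N -> (iter k f 1%N < 31)%N.
  by case: k => // k _; rewrite /= ltn_mod.
have u30 : uniq (traject f 1%N 30) by vm_compute.
have nat_inj (a b : nat) : (a < 31)%N -> (b < 31)%N -> a%:R = b%:R :> 'F_31 -> a = b.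
  move=> a31 b31 ab; have p31 : prime 31 by [].
  rewrite -(modn_small a31) -(modn_small b31) -!(val_Fp_nat p31).
  by rewrite ab.
move=> j k j30 k30 jk; have {}jk : iter j f 1%N = iter k f 1%N.
  by apply: nat_inj; [exact: lt31|exact: lt31|rewrite -!powE].
move: {powE lt31 nat_inj} f u30 jk => f u30 jk.
have sz : size (traject f 1%N 30) = 30%N := size_traject f 1%N 30.
apply/eqP; rewrite -(nth_uniq 1%N _ _ u30) ?sz //.
by rewrite (nth_traject _ j30) (nth_traject _ k30) jk.
Qed.

Section Orbits.
Variables (K : fieldType) (phi : {rmorphism 'F_31 -> K}).

Let charK : 31 \in [pchar K].
Proof. by rewrite (fmorph_pchar phi) pchar_Fp. Qed.

Lemma char31K : 31%:R = 0 :> K.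
Proof. exact: pcharf0 charK. Qed.

Let F : {rmorphism K -> K} := pFrobenius_aut charK.

Let phi_fermat a : phi a ^+ 31 = phi a.
Proof. by rewrite -rmorphXn; have := expf_card a; rewrite card_Fp // => ->. Qed.

Lemma root_Frobenius (q : {poly 'F_31}) x :
  (map_poly phi q).[x] = 0 -> (map_poly phi q).[x ^+ 31] = 0.
Proof.
move=> q0; have := congr1 F q0; rewrite rmorph0 -horner_map -map_poly_comp.
rewrite (eq_map_poly (g := phi)) => [|a]; first by rewrite /= pFrobenius_autE.
by rewrite /= pFrobenius_autE phi_fermat.
Qed.

(** Frobenius preserves the roots of a polynomial over F_31, so thirty distinct conjugates force
    degree at least 30. *)
Lemma size_of_orbit (q : {poly 'F_31}) (x : nat -> K) :
  q != 0 -> (map_poly phi q).[x 0%N] = 0 ->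
  (forall k, x k.+1 = x k ^+ 31) -> {in gtn 30%N &, injective x} ->
  (30 < size q)%N.
Proof.
move=> q0 qx xS x_inj.
have qx' k : (map_poly phi q).[x k] = 0.
  by elim: k => // k IH; rewrite xS root_Frobenius.
have : (size (map x (iota 0 30)) < size (map_poly phi q))%N.
  apply: max_poly_roots; first by rewrite map_poly_eq0.
    by apply/allP => _ /mapP[k _ ->]; apply/rootP.
  rewrite map_inj_in_uniq ?iota_uniq // => j k.
  by rewrite !mem_iota; apply: x_inj.
by rewrite size_map size_iota size_map_poly.
Qed.

Variable t : K.
Hypothesis t30 : t ^+ 30 = 3.

Let t0 : t != 0.
Proof.
have three0 : 3 != 0 :> K.
  rewrite -(rmorph_nat phi) fmorph_eq0.
  by [].
by apply: contra_neq three0 => t0; rewrite -t30 t0 expr0n.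
Qed.

(** The Frobenius conjugates of t, as t^31 = t^30 t = 3 t. *)
Let t_ k := 3%:R ^+ k * t.

Let tS k : t_ k.+1 = t_ k ^+ 31.
Proof.
have fermat : 3%:R ^+ 31 = 3%:R :> K.
  by have := phi_fermat 3%:R; rewrite rmorph_nat.
by rewrite /t_ exprMn exprS exprAC fermat (exprS t 30) t30; ring.
Qed.

(** Thus t has degree 30 over F_31, and 1, t, ..., t^29 are linearly independent. *)
Lemma small_root_t (q : {poly 'F_31}) :
  (size q <= 30)%N -> (map_poly phi q).[t] = 0 -> q = 0.
Proof.
move=> sq qt; apply/eqP; apply: contraLR sq => q0; rewrite -ltnNge.
apply: (@size_of_orbit q t_ q0) => // [|j k j30 k30]; first by rewrite /t_ mul1r.
move=> /(mulIf t0); rewrite -!(rmorph_nat phi) -!(rmorphXn phi) => /fmorph_inj e.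
exact: (pow3_inj j30 k30 e).
Qed.

(** The conjugates of the value of l at t are its values at 3^k t. By independence of the powers of
    t, two of them agree only coefficientwise, and the nonzero coefficient of theta then yields 3^j
    = 3^k. *)
Lemma size_root_leval (q : {poly 'F_31}) l :
  (size l <= 30)%N -> (nth 0%N l 1)%:R != 0 :> 'F_31 ->
  q != 0 -> (map_poly phi q).[leval t l] = 0 -> (30 < size q)%N.
Proof.
move=> sl l1 q0 qt.
apply: (@size_of_orbit q (fun k => leval (t_ k) l) q0) => [|k|j k j30 k30].
- by rewrite /t_ mul1r.
- by rewrite tS -!(pFrobenius_autE charK) [RHS](leval_morph F).
have evE n : leval (t_ n) l = (map_poly phi (leval (3%:R ^+ n *: 'X) l)).[t].
  have -> : (map_poly phi (leval (3%:R ^+ n *: 'X) l)).[t] =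
     (horner_eval t \o map_poly phi) (leval (3%:R ^+ n *: 'X) l) by [].
  rewrite leval_morph /= /horner_eval map_polyZ map_polyX hornerZ hornerX.
  by rewrite rmorphXn rmorph_nat.
move=> /eqP; rewrite -subr_eq0 !evE -hornerN -hornerD -rmorphB => /eqP /small_root_t h.
have /polyP/(_ 1%N) : leval (3%:R ^+ j *: 'X) l - leval (3%:R ^+ k *: 'X) l = 0 :> {poly 'F_31}.
  apply: h; rewrite (leq_trans (size_polyD _ _)) // geq_max size_polyN.
  by rewrite !(leq_trans (size_leval _ _)).
rewrite coefB !coef_leval !expr1 coef0 -mulrBr => /eqP.
rewrite mulf_eq0 (negbTE l1) subr_eq0 => /eqP e.
exact: (pow3_inj j30 k30 e).
Qed.

End Orbits.

(** * Irreducibility of P at integer values in a residue class modulo 31 *)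

Section Irreducibility.
Variables (P : Zus) (e : nat -> int).
Hypothesis PE : Znorm Dres = P * zu2 ^+ 12.
Hypothesis e31 : forall k, (0 < k < 7)%N -> (e k)%:~R = (cert_sigma k)%:R :> 'F_31.

Let red : {rmorphism int -> 'F_31} := intr.

Lemma cert_root (K : fieldType) (phi : {rmorphism 'F_31 -> K}) (t : K) :
  t ^+ 30 = 3 -> (map_poly phi (map_poly red (uhom e P))).[leval t cert_u] = 0.
Proof.
move=> t30; set u := leval t cert_u.
have char31 := char31K phi.
(* The coefficient of theta in [cert_u] is 3, so u has degree 30 over F_31, whereas 0 is a root of
   X. *)
have red_u0 : u != 0.
  apply/eqP => u0; have : (30 < size ('X : {poly 'F_31}))%N.
    apply: (@size_root_leval K phi t t30 'X cert_u) => //.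
    - by rewrite polyX_eq0.
    - by rewrite map_polyX hornerX.
  by rewrite size_polyX.
pose psi : {rmorphism Zus -> K} :=
  horner_eval u \o (map_poly phi \o (map_poly red \o uhom e)).
have psiE p : psi p = (map_poly phi (map_poly red (uhom e p))).[u] by [].
rewrite -psiE.
have psi_u : psi zu2 = u by rewrite psiE uhom_u2 !map_polyX hornerX.
have psi_s k : (0 < k < 7)%N -> psi (zsigma k) = (cert_sigma k)%:R.
  move=> k7; rewrite psiE uhom_sigma // !map_polyC hornerC /=.
  by rewrite e31 // rmorph_nat.
set s := leval t cert_s.
have s2 : s ^+ 2 = - (psi zu2 * psi (zsigma 6)).
  rewrite psi_u psi_s //; apply/eqP; rewrite -addr_eq0 expr2.
  have := leval0 t cert_s2; rewrite leval_add // leval_mul // leval_scale //.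
  rewrite (_ : cert_sigma 6 = 14%N) // [u * _]mulrC. by move=> /eqP.
have FE : Fval (leval t cert_x) (psi zu2) s (psi \o zsigma) = 0.
  rewrite psi_u -(leval_Fval _ _ _ char31 t30 (c1 := 26) (c2 := 29) (c3 := 0) (c4 := 20));
    by [exact: (leval0 t cert_F)|exact: psi_s].
have GE : Gval (leval t cert_x) (psi zu2) s (psi \o zsigma) = 0.
  rewrite psi_u -(leval_Gval _ _ _ char31 t30 (c1 := 26) (c2 := 29) (c3 := 0) (c5 := 17));
    by [exact: (leval0 t cert_G)|exact: psi_s].
have := morph_Znorm Dres s2; rewrite (Dres_common_root FE GE) mul0r PE.
have psiM (p q : Zus) k : psi (p * q ^+ k) = psi p * psi q ^+ k.
  by rewrite rmorphM rmorphXn.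
rewrite psiM psi_u => /eqP; rewrite mulf_eq0 expf_eq0 (negbTE red_u0) andbF orbF.
by move=> /eqP.
Qed.

(** A rational factor is proportional to an integral one. Modulo 31 no factor dies, because 2^196
    stays nonzero, and the factor vanishing at the certified element of degree 30 takes up the whole
    degree. *)
Lemma uhom_irreducible : irreducible_poly (map_poly (intr : int -> rat) (uhom e P)).
Proof.
have two0 : (2%:R : int) ^+ 196 != 0 by rewrite expf_neq0.
have [sk lk] := has_top_lead two0 (top_uhom_P PE e).
have red2 : red (lead_coef (uhom e P)) != 0.
  by rewrite lk rmorphXn rmorph_nat expf_neq0.
move: cert_root sk red2 {lk}; move: (uhom e P) => k rootk sk red2.
have [K [phi _]] := countable_algebraic_closure 'F_31.
have [t t30] : exists t : K, t ^+ 30 = 3.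
  have [t] := solve_monicpoly (fun i => if i is 0 then 3 else 0 : K) (isT : (0 < 30)%N).
  rewrite big_ord_recl big1 => [|i _]; last by rewrite mul0r.
  by rewrite addr0 expr0 mulr1; exists t.
have {}rootk := rootk _ phi t t30.
have inj_int : injective (intr : int -> rat) := @intr_inj _.
have skQ : size (map_poly (intr : int -> rat) k) = 31%N.
  by rewrite size_map_inj_poly.
split=> [|q q1 /dvdpP_rat_int [p1 [a a0 qE] [r kE]]]; first by rewrite skQ.
have pr : map_poly red k = map_poly red p1 * map_poly red r by rewrite kE rmorphM.
have k0 : map_poly red k != 0.
  by rewrite -lead_coef_eq0 lead_coef_map_eq.
have [p0 r0] : map_poly red p1 != 0 /\ map_poly red r != 0.
  by move: k0; rewrite pr mulf_eq0 negb_or => /andP.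
have sizes : (size p1 + size r = 32)%N.
  have [p10 r10] : p1 != 0 /\ r != 0.
    by split; apply: contraNneq k0 => z; rewrite kE z ?mul0r ?mulr0 rmorph0.
  have := size_mul p10 r10; rewrite -kE sk.
  by move: p10 r10; rewrite -!size_poly_gt0; move: (size p1) (size r) => m n; lia.
have sq : size q = size p1 by rewrite qE size_scale // size_map_inj_poly.
have qk : q %| map_poly intr k.
  by rewrite qE dvdpZl // kE rmorphM dvdp_mulr.
have big (f : {poly int}) : map_poly red f != 0 ->
    (map_poly phi (map_poly red f)).[leval t cert_u] = 0 -> (30 < size f)%N.
  move=> f0 f_root; apply: leq_trans (size_poly _ _).
  by apply: (@size_root_leval K phi t t30 _ cert_u) f_root.
have [s1 s2] : (0 < size p1)%N /\ (0 < size r)%N.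
  split; rewrite size_poly_gt0; [apply: contraNneq p0|apply: contraNneq r0] => ->;
  by rewrite rmorph0.
move/eqP: rootk; rewrite pr rmorphM hornerM mulf_eq0 => /orP[] /eqP.
  move/(big _ p0) => h; rewrite -dvdp_size_eqp // skQ sq.
  by move: s1 s2 sizes h; move: (size p1) (size r) => m n; lia.
move/(big _ r0) => h; move: q1 s1 s2 sizes h; rewrite sq.
by move: (size p1) (size r) => m n; lia.
Qed.

End Irreducibility.

(** * Semicyclic heptagons *)

(* In the notation of the paper, with x_i = a_i^2, the polynomial prod (T + x_i) of a semicyclic polygon is T (T + 4 r^2) (T^2 + al T + be)^2 + (b2 T^2 + b1 T + b0)^2, so that t_1 = 2 al, t_2 = - 2 be, t_3 = 2 b2 b1, t_4 = - b1^2 - 2 b2 b0, t_5 = 2 b1 b0, t_6 = - b0^2 and u_2 = - b2^2. *)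
Section CommonRoot.
Variables (A : comNzRingType) (y al be b0 b1 b2 : A) (e : nat -> A).
Hypotheses (e1 : e 1%N = 2 * al + 4 * y)
  (e2 : e 2%N = al ^+ 2 + 2 * be + 8 * y * al + b2 ^+ 2)
  (e3 : e 3%N = 2 * al * be + 4 * y * (al ^+ 2 + 2 * be) + 2 * b2 * b1)
  (e4 : e 4%N = be ^+ 2 + 8 * y * al * be + b1 ^+ 2 + 2 * b2 * b0)
  (e5 : e 5%N = 4 * y * be ^+ 2 + 2 * b1 * b0)
  (e6 : e 6%N = b0 ^+ 2).

Let T1E : T1 y e = 2 * al.
Proof. by rewrite /T1 e1; ring. Qed.
Let T2E : T2 y (- b2 ^+ 2) e = - 8 * be.
Proof. by rewrite /T2 T1E e2; ring. Qed.
Let T3E : T3 y (- b2 ^+ 2) e = 16 * b2 * b1.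
Proof. by rewrite /T3 T2E T1E e3; ring. Qed.
Let T4E : T4 y (- b2 ^+ 2) e = - 64 * b1 ^+ 2 - 128 * b2 * b0.
Proof. by rewrite /T4 T2E T1E e4; ring. Qed.
Let T5E : T5 y (- b2 ^+ 2) e = 128 * b1 * b0.
Proof. by rewrite /T5 T2E e5; ring. Qed.

Lemma common_root_F : Fval y (- b2 ^+ 2) (- (b2 * b0)) e = 0.
Proof. by rewrite /Fval T3E T4E; ring. Qed.

Lemma common_root_G : Gval y (- b2 ^+ 2) (- (b2 * b0)) e = 0.
Proof. by rewrite /Gval T3E T5E; ring. Qed.

Lemma common_root_s : (- (b2 * b0)) ^+ 2 = - (- b2 ^+ 2 * e 6%N).
Proof. by rewrite e6; ring. Qed.

End CommonRoot.

Lemma mesym_coef (K : idomainType) n (x : 'I_n -> K) k : (k <= n)%N ->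
  meval x (mesym n K k) = (\prod_(i < n) ('X + (x i)%:P))`_(n - k).
Proof.
move=> kn; pose t : n.-tuple K := [tuple - x i | i < n].
have kn' : (k < n.+1)%N by [].
have := mroots_coeff t (Ordinal kn'); rewrite big_tuple /=.
under eq_bigr do rewrite tnth_mktuple polyCN opprK.
move=> ->; rewrite /mesym !raddf_sum mulr_sumr; apply: eq_bigr => h /eqP hk.
rewrite /= !rmorph_prod /= -hk -prodrN; apply: eq_bigr => i _.
by rewrite !mevalXU tnth_mktuple opprK.
Qed.

Lemma big_inord6 (R : Type) (idx : R) (op : Monoid.law idx) (F : 'I_6 -> R) :
  \big[op/idx]_(i < 6) F i =
  op (op (op (F (inord 0)) (F (inord 1))) (op (F (inord 2)) (F (inord 3))))
    (op (F (inord 4)) (F (inord 5))).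
Proof.
rewrite (eq_bigr (fun i : 'I_6 => F (inord i))) => [|i _]; last by rewrite inord_val.
by rewrite !big_ord_recl big_ord0 Monoid.mulm1 !Monoid.mulmA.
Qed.

Lemma semicyclic_expansion (A : comNzRingType) (y al be b0 b1 b2 : A) :
  'X * ('X + (4 * y)%:P) * ('X ^+ 2 + al%:P * 'X + be%:P) ^+ 2 +
   (b2%:P * 'X ^+ 2 + b1%:P * 'X + b0%:P) ^+ 2 =
  (((((('X + (2 * al + 4 * y)%:P) * 'X
    + (al ^+ 2 + 2 * be + 8 * y * al + b2 ^+ 2)%:P) * 'X
    + (2 * al * be + 4 * y * (al ^+ 2 + 2 * be) + 2 * b2 * b1)%:P) * 'X
    + (be ^+ 2 + 8 * y * al * be + b1 ^+ 2 + 2 * b2 * b0)%:P) * 'X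
    + (4 * y * be ^+ 2 + 2 * b1 * b0)%:P) * 'X + (b0 ^+ 2)%:P) :> {poly A}.
Proof.
rewrite !(rmorph_nat, rmorphXn, rmorphM, rmorphD) /=.
by move: (al%:P) (be%:P) (b0%:P) (b1%:P) (b2%:P) (y%:P) => {}al {}be {}b0 {}b1 {}b2 {}y; ring.
Qed.

Lemma coef_horner6 (A : comNzRingType) (c1 c2 c3 c4 c5 c6 : A) :
  let p : {poly A} := (((((('X + c1%:P) * 'X + c2%:P) * 'X + c3%:P) * 'X + c4%:P) * 'X
    + c5%:P) * 'X + c6%:P) in
  [/\ p`_(6 - 1) = c1, p`_(6 - 2) = c2, p`_(6 - 3) = c3, p`_(6 - 4) = c4 &
      p`_(6 - 5) = c5 /\ p`_(6 - 6) = c6].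
Proof.
by split; [| | | |split]; rewrite !(coefD, coefMX, coefX, coefC) /= ?(addr0, add0r).
Qed.

Section SemicyclicAlgebra.
Variables (K : numFieldType) (y : K) (c s : 'I_6 -> K).
Hypothesis circ : forall i, c i ^+ 2 + s i ^+ 2 = 1.

(** For c = cos phi and s = sin phi, [pair_re] and [pair_im] are the cosine and sine of phi_i +
    phi_j. If w^2 = -T (T + 4 y), then (c_i T + s_i w) (c_j T + s_j w) is T times [pair_re] T -
    [pair_de] + [pair_im] w; each pair thus releases one factor T. The hypotheses below express that
    the three pair sums add up to pi/2. *)
Definition pair_re (i j : 'I_6) := c i * c j - s i * s j.
Definition pair_im (i j : 'I_6) := c i * s j + s i * c j.
Definition pair_de (i j : 'I_6) := 4 * y * (s i * s j).

Let o (k : nat) : 'I_6 := inord k.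
Let p0 := pair_re (o 0) (o 1). Let q0 := pair_im (o 0) (o 1). Let d0 := pair_de (o 0) (o 1).
Let p1 := pair_re (o 2) (o 3). Let q1 := pair_im (o 2) (o 3). Let d1 := pair_de (o 2) (o 3).
Let p2 := pair_re (o 4) (o 5). Let q2 := pair_im (o 4) (o 5). Let d2 := pair_de (o 4) (o 5).

Hypotheses (re0 : p1 * p2 - q1 * q2 = q0) (re1 : p0 * p2 - q0 * q2 = q1)
  (re2 : p0 * p1 - q0 * q1 = q2).
Hypotheses (im0 : q1 * p2 + p1 * q2 = p0) (im1 : q0 * p2 + p0 * q2 = p1)
  (im2 : q0 * p1 + p0 * q1 = p2).

(** Expand the product of the three p_i T - d_i + q_i w as B + w A. Then A = T^2 + [hal] T + [hbe]
    and B = [hb2] T^2 + [hb1] T + [hb0], once the angle relations fix the top coefficients. *)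
Definition hal := - ((p0 * d1 + d0 * p1) * q2 + (p0 * d2 + d0 * p2) * q1 +
  (p1 * d2 + d1 * p2) * q0) - 4 * y * (q0 * q1 * q2).
Definition hbe := d0 * d1 * q2 + d0 * d2 * q1 + d1 * d2 * q0.
Definition hb2 := d0 * (q1 * q2 - p1 * p2) + d1 * (q0 * q2 - p0 * p2) +
  d2 * (q0 * q1 - p0 * p1) - 4 * y * (p0 * q1 * q2 + q0 * p1 * q2 + q0 * q1 * p2).
Definition hb1 := p0 * d1 * d2 + d0 * p1 * d2 + d0 * d1 * p2 +
  4 * y * (d0 * q1 * q2 + q0 * d1 * q2 + q0 * q1 * d2).
Definition hb0 := - (d0 * d1 * d2).

Let pair_norm i j T :
  (T + 4 * y * s i ^+ 2) * (T + 4 * y * s j ^+ 2) =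
  (pair_re i j * T - pair_de i j) ^+ 2 + T * (T + 4 * y) * pair_im i j ^+ 2.
Proof.
transitivity ((T * (c i ^+ 2 + s i ^+ 2) + 4 * y * s i ^+ 2) *
  (T * (c j ^+ 2 + s j ^+ 2) + 4 * y * s j ^+ 2)); first by rewrite !circ !mulr1.
by rewrite /pair_re /pair_im /pair_de; ring.
Qed.

Let pair_circ i j : pair_re i j ^+ 2 + pair_im i j ^+ 2 = 1.
Proof.
transitivity ((c i ^+ 2 + s i ^+ 2) * (c j ^+ 2 + s j ^+ 2)).
  by rewrite /pair_re /pair_im; ring.
by rewrite !circ mulr1.
Qed.

(** Multiplicativity of the norm over the three pairs. The top coefficients [reE] of B and [imE] of
    A are the cosine and sine of pi/2. *)
Lemma semicyclic_norm T : \prod_(i < 6) (T + 4 * y * s i ^+ 2) =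
  T * (T + 4 * y) * (T ^+ 2 + hal * T + hbe) ^+ 2 + (hb2 * T ^+ 2 + hb1 * T + hb0) ^+ 2.
Proof.
rewrite big_inord6 /= !pair_norm.
have c0 := pair_circ (o 0) (o 1); have c1 := pair_circ (o 2) (o 3).
have c2 := pair_circ (o 4) (o 5).
rewrite -/p0 -/q0 -/d0 in c0 *; rewrite -/p1 -/q1 -/d1 in c1 *.
rewrite -/p2 -/q2 -/d2 in c2 *.
have reE : p0 * p1 * p2 - p0 * q1 * q2 - q0 * p1 * q2 - q0 * q1 * p2 = 0.
  transitivity (p0 * (p1 * p2 - q1 * q2) - q0 * (q1 * p2 + p1 * q2)); first by ring.
  by rewrite re0 im0; ring.
have imE : q0 * p1 * p2 + p0 * q1 * p2 + p0 * p1 * q2 - q0 * q1 * q2 = 1.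
  transitivity (q0 * (p1 * p2 - q1 * q2) + p0 * (q1 * p2 + p1 * q2)); first by ring.
  by rewrite re0 im0 -c0; ring.
have -> : T ^+ 2 + hal * T + hbe =
    (q0 * p1 * p2 + p0 * q1 * p2 + p0 * p1 * q2 - q0 * q1 * q2) * T ^+ 2 + hal * T + hbe.
  by rewrite imE mul1r.
have -> : hb2 * T ^+ 2 + hb1 * T + hb0 =
    (p0 * p1 * p2 - p0 * q1 * q2 - q0 * p1 * q2 - q0 * q1 * p2) * T ^+ 3 +
    hb2 * T ^+ 2 + hb1 * T + hb0.
  by rewrite reE mul0r add0r.
rewrite /hal /hbe /hb2 /hb1 /hb0; ring.
Qed.

(* hb2 is the opposite of twice the signed area. *)
Lemma hb2E : hb2 = - 2 * y * \sum_(i < 6) s i * c i.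
Proof.
have sumE i j : s i * c i + s j * c j = pair_im i j * (pair_re i j + 2 * (s i * s j)).
  transitivity (s i * c i * (c j ^+ 2 + s j ^+ 2) + s j * c j * (c i ^+ 2 + s i ^+ 2)).
    by rewrite !circ !mulr1.
  by rewrite /pair_im /pair_re; ring.
rewrite big_inord6 /= !sumE.
rewrite -/p0 -/q0 -/p1 -/q1 -/p2 -/q2.
(* Sum of the three relations [im0], [im1], [im2] multiplied by q0, q1, q2. *)
have e : 2 * (p0 * q1 * q2 + q0 * p1 * q2 + q0 * q1 * p2) = q0 * p0 + q1 * p1 + q2 * p2.
  rewrite -[X in _ = q0 * X + _ + _]im0 -[X in _ = _ + q1 * X + _]im1.
  by rewrite -[X in _ = _ + q2 * X]im2; ring.
rewrite /hb2 -[q1 * q2 - _]opprB -[q0 * q2 - _]opprB -[q0 * q1 - _]opprB re0 re1 re2.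
rewrite (_ : 4 * y * _ = 2 * y * (2 * (p0 * q1 * q2 + q0 * p1 * q2 + q0 * q1 * p2))); last by ring.
by rewrite e /d0 /d1 /d2 /pair_de; ring.
Qed.

Let e k : K := meval (fun i => 4 * y * s i ^+ 2) (mesym 6 K k).

Let coefs : \prod_(i < 6) ('X + (4 * y * s i ^+ 2)%:P) =
  'X * ('X + (4 * y)%:P) * ('X ^+ 2 + hal%:P * 'X + hbe%:P) ^+ 2 +
   (hb2%:P * 'X ^+ 2 + hb1%:P * 'X + hb0%:P) ^+ 2 :> {poly K}.
Proof.
apply/eqP; rewrite -subr_eq0; apply/eqP.
apply: (@poly_eq0_inj _ _ (fun k => k%:R)) => [i j /eqP|n].
  by rewrite eqr_nat => /eqP.
rewrite hornerD hornerN horner_prod.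
under eq_bigr do rewrite hornerD hornerX hornerC.
by rewrite semicyclic_norm !hornerE subrr.
Qed.

(** Of the two square roots, s = - b_2 b_0 is the one for which F and G vanish together at r^2 =
    y. *)
Lemma semicyclic_common_root :
  [/\ Fval y (- hb2 ^+ 2) (- (hb2 * hb0)) e = 0,
      Gval y (- hb2 ^+ 2) (- (hb2 * hb0)) e = 0 &
      (- (hb2 * hb0)) ^+ 2 = - (- hb2 ^+ 2 * e 6%N)].
Proof.
have eE k : (k <= 6)%N -> e k = (\prod_(i < 6) ('X + (4 * y * s i ^+ 2)%:P))`_(6 - k).
  exact: mesym_coef.
have [e1 e2 e3 e4 [e5 e6]] := coef_horner6 (2 * hal + 4 * y)
  (hal ^+ 2 + 2 * hbe + 8 * y * hal + hb2 ^+ 2)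
  (2 * hal * hbe + 4 * y * (hal ^+ 2 + 2 * hbe) + 2 * hb2 * hb1)
  (hbe ^+ 2 + 8 * y * hal * hbe + hb1 ^+ 2 + 2 * hb2 * hb0)
  (4 * y * hbe ^+ 2 + 2 * hb1 * hb0) (hb0 ^+ 2).
rewrite -semicyclic_expansion -coefs in e1 e2 e3 e4 e5 e6.
rewrite -(eE 1%N isT) in e1; rewrite -(eE 2%N isT) in e2; rewrite -(eE 3%N isT) in e3.
rewrite -(eE 4%N isT) in e4; rewrite -(eE 5%N isT) in e5; rewrite -(eE 6%N isT) in e6.
split; first exact: common_root_F e1 e2 e3 e4.
  exact: common_root_G e1 e2 e3 e5.
exact: common_root_s e6.
Qed.

End SemicyclicAlgebra.

(** * Construction of heptagons with prescribed sides *)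

Lemma continuous_sum (R : realType) n (F : 'I_n -> R -> R) :
  (forall i, continuous (F i)) -> continuous (fun x => \sum_(i < n) F i x).
Proof.
move=> cF; have -> : (fun x => \sum_(i < n) F i x) = \sum_(i < n) F i.
  by rewrite fct_sumE.
elim/big_ind: _ => [|f g cf cg|//]; first by move=> x; apply: cst_continuous.
by move=> x; apply: continuousD; [apply: cf|apply: cg].
Qed.

(** The only unknown is the half angle x of the long side: a_i = 2 r sin phi_i forces phi_i = asin
    (l_i sin x) with l_i = a_i / a_0 < 1. The sum of the angles is 0 at x = 0 and at least pi/2 at x
    = pi/2, so some x gives pi/2 exactly; r is then determined by the long side. *)
Lemma exists_angles (R : realType) (e : 'I_6 -> R) :
  1 <= e ord0 -> (forall i, i != ord0 -> 0 < e i < 1) ->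
  exists (phi : 'I_6 -> R) (r : R),
    [/\ 0 < r, \sum_i phi i = pi / 2, forall i, 4 * r ^+ 2 * sin (phi i) ^+ 2 = e i,
        forall i, 0 < sin (phi i) & forall i, 0 <= cos (phi i)] /\
    forall i, i != ord0 -> 0 < cos (phi i).
Proof.
move=> e0 ei.
have e0_gt0 : 0 < e ord0 by apply: lt_le_trans e0.
have pihalf_gt0 : 0 < pi / 2 :> R by rewrite divr_gt0 ?pi_gt0.
pose l i : R := Num.sqrt (e i / e ord0).
have l01 i : i != ord0 -> 0 < l i < 1.
  move=> i0; have /andP[ei0 ei1] := ei i i0.
  rewrite /l sqrtr_gt0 divr_gt0 //= -[X in _ < X]sqrtr1 ltr_sqrt //.
  by rewrite ltr_pdivrMr // mul1r (lt_le_trans ei1).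
have l2 i : l i ^+ 2 * e ord0 = e i.
  rewrite /l sqr_sqrtr ?divfK ?gt_eqF //; apply: divr_ge0; last exact: ltW.
  have [->|i0] := eqVneq i ord0; first exact: ltW.
  by have /andP[/ltW] := ei i i0.
have bnd (i : 'I_5) (x : R) : -1 < l (lift ord0 i) * sin x < 1.
  have /andP[li0 li1] : 0 < l (lift ord0 i) < 1 by apply: l01.
  rewrite -ltr_norml normrM (gtr0_norm li0).
  have s1 : `|sin x| <= 1 by rewrite ler_norml sin_geN1 sin_le1.
  by apply: le_lt_trans li1; rewrite ger_pMr.
pose g (x : R) := x + \sum_(i < 5) asin (l (lift ord0 i) * sin x).
have cont_g : continuous g.
  move=> x; apply: continuousD; first exact: cvg_id.
  move: x; apply: continuous_sum => i x.
  apply: (@continuous_comp _ _ _ (fun x => l (lift ord0 i) * sin x) asin).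
    by apply: continuousM; [exact: cvg_cst|exact: continuous_sin].
  exact: continuous_asin.
have asin0 : asin 0 = 0 :> R.
  by rewrite -[X in asin X]sin0 sinK // in_itv /= oppr_le0 !ltW.
have g0 : g 0 = 0.
  by rewrite /g sin0 big1 ?addr0 // => i _; rewrite mulr0 asin0.
have asin_pos (i : 'I_5) x : 0 < sin x -> 0 < asin (l (lift ord0 i) * sin x) < pi / 2.
  move=> sx; have /andP[b1 b2] := bnd i x.
  have /andP[li0 _] : 0 < l (lift ord0 i) < 1 by apply: l01.
  have [/andP[h1 h2] hs] := asin_def (x := l (lift ord0 i) * sin x) (introT andP (conj (ltW b1) (ltW b2))).
  rewrite asin_ltpi2 ?(ltW b1) // andbT.
  rewrite -(ltr_sin (x := 0)) ?in_itv /= ?h1 ?h2 ?oppr_le0 ?(ltW pihalf_gt0) //.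
  by rewrite sin0 hs mulr_gt0.
have gpi : pi / 2 <= g (pi / 2).
  rewrite /g lerDl; apply: sumr_ge0 => i _.
  have s1 : 0 < sin (pi / 2) :> R by rewrite sin_pihalf.
  by have /andP[/ltW] := asin_pos i _ s1.
have [|x] := @IVT R g 0 (pi / 2) (pi / 2) (ltW pihalf_gt0) (continuous_subspaceT cont_g).
  by rewrite g0 ge_min le_max gpi (ltW pihalf_gt0) orbT.
rewrite in_itv /= => /andP[x0 xpi] gx.
have {}x0 : 0 < x.
  rewrite lt_neqAle x0 andbT; apply/eqP => x0'.
  by move: gx; rewrite -x0' g0 => /eqP; rewrite lt_eqF.
have sx : 0 < sin x.
  rewrite -[X in X < _]sin0 ltr_sin // in_itv /= ?oppr_le0 ?lexx ?(ltW pihalf_gt0) //.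
  by rewrite xpi andbT (le_trans _ (ltW x0)) // oppr_le0 ltW.
pose phi i := if unlift ord0 i is Some j then asin (l (lift ord0 j) * sin x) else x.
pose r := Num.sqrt (e ord0) / (2 * sin x).
have sin_phi i : sin (phi i) = (if i == ord0 then 1 else l i) * sin x.
  rewrite /phi; case: unliftP => [j ->|->]; last by rewrite eqxx mul1r.
  have /andP[b1 b2] := bnd j x; rewrite eq_sym (negbTE (neq_lift _ _)).
  by rewrite asinK // in_itv /= !ltW.
exists phi, r; split; first split.
- by rewrite divr_gt0 ?sqrtr_gt0 // mulr_gt0.
- rewrite -[RHS]gx big_ord_recl /g /phi unlift_none; congr (_ + _).
  by apply: eq_bigr => i _; rewrite liftK.
- move=> i; rewrite sin_phi /r expr_div_n sqr_sqrtr ?(ltW e0_gt0) // !exprMn.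
  have -> : 4 * (e ord0 / (2 ^+ 2 * sin x ^+ 2)) *
      ((if i == ord0 then 1 else l i) ^+ 2 * sin x ^+ 2) =
      (if i == ord0 then 1 else l i) ^+ 2 * e ord0.
    by field; rewrite gt_eqF.
  by case: eqP => [->|_]; rewrite ?expr1n ?mul1r.
- move=> i; rewrite sin_phi mulr_gt0 //; case: eqVneq => // /l01.
  by case/andP.
- move=> i; apply: cos_ge0_pihalf; rewrite /phi; case: unlift => [j|].
    by have /andP[/ltW h1 /ltW ->] := asin_pos j x sx; rewrite andbT (le_trans _ h1) // oppr_le0 ltW.
  by rewrite xpi andbT (le_trans _ (ltW x0)) // oppr_le0 ltW.
move=> i i0; apply: cos_gt0_pihalf; rewrite /phi; case: unliftP i0 => [j -> _|->]; last by rewrite eqxx.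
by have /andP[h1 ->] := asin_pos j x sx; rewrite andbT (lt_trans _ h1) // oppr_lt0.
Qed.

Section InscribedPolygon.
Variables (R : realType) (phi : 'I_6 -> R) (r : R).
Hypotheses (r0 : 0 < r) (sum_phi : \sum_i phi i = pi / 2).

(** [phi i] is half the central angle over the i-th side, so this is the polar angle of vertex k.
    The total pi makes the closing side, from vertex 6 to vertex 0, a diameter. *)
Definition angle (k : nat) : R := \sum_(i < 6 | (i < k)%N) (phi i *+ 2).

Definition inscribed (i : 'I_7) : R * R := (r * cos (angle i), r * sin (angle i)).

Lemma angle0 : angle 0 = 0.
Proof. by rewrite /angle big_pred0. Qed.

Lemma angle6 : angle 6 = pi.
Proof.
rewrite /angle (eq_bigl xpredT) => [|i]; last by rewrite ltn_ord.
by rewrite sumrMnl sum_phi -[LHS]mulr_natr divfK // pnatr_eq0.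
Qed.

Lemma angleS (i : 'I_6) : angle i.+1 = angle i + phi i *+ 2.
Proof.
rewrite /angle (bigD1 i) ?ltnSn //= addrC; congr (_ + _).
apply: eq_bigl => j; rewrite ltnS ltn_neqAle andbC.
by rewrite -(inj_eq val_inj).
Qed.

Lemma lift_max_val (i : 'I_6) : lift ord_max i = i :> nat.
Proof. by rewrite /= /bump leqNgt ltn_ord. Qed.

Lemma ordS_lift_max (i : 'I_6) : ordS (lift ord_max i) = i.+1 :> nat.
Proof. by rewrite -[LHS]/((lift ord_max i).+1 %% 7)%N lift_max_val modn_small // ltnS. Qed.

Lemma inscribed_semicyclic : semicyclic inscribed ord_max.
Proof.
exists (0, 0), r; split => // [i|].
  rewrite /Defs.edist /inscribed /= !sub0r !sqrrN !exprMn -mulrDr cos2Dsin2 mulr1.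
  by rewrite sqrtr_sqr gtr0_norm.
have -> : ordS ord_max = ord0 :> 'I_7 by apply: val_inj.
rewrite /inscribed /= angle0 angle6 cos0 sin0 cospi sinpi !mulr0 mulr1 mulrN1.
by apply/eqP; rewrite xpair_eqE /= subr0 opprK add0r !eqxx.
Qed.

Let rot (a b : R) :
  (cos (a + b *+ 2) = cos a * (1 - 2 * sin b ^+ 2) - sin a * (2 * sin b * cos b)) *
  (sin (a + b *+ 2) = sin a * (1 - 2 * sin b ^+ 2) + cos a * (2 * sin b * cos b)).
Proof.
have c2 : cos (b *+ 2) = 1 - 2 * sin b ^+ 2.
  rewrite mulr2n cosD; transitivity (cos b ^+ 2 + sin b ^+ 2 - 2 * sin b ^+ 2); first by ring.
  by rewrite cos2Dsin2.
have s2 : sin (b *+ 2) = 2 * sin b * cos b by rewrite mulr2n sinD; ring.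
by rewrite cosD sinD c2 s2.
Qed.

Lemma side_inscribed (i : 'I_6) :
  side_length inscribed (lift ord_max i) ^+ 2 = 4 * r ^+ 2 * sin (phi i) ^+ 2.
Proof.
rewrite /side_length /Defs.edist sqr_sqrtr ?addr_ge0 ?sqr_ge0 // /inscribed.
rewrite ordS_lift_max lift_max_val /= angleS !rot.
have := cos2Dsin2 (angle i); have := cos2Dsin2 (phi i).
move: (cos (angle i)) (sin (angle i)) (cos (phi i)) (sin (phi i)) => c s C S e1 e2.
transitivity (4 * r ^+ 2 * S ^+ 2 * (c ^+ 2 + s ^+ 2) * (C ^+ 2 + S ^+ 2)); first by ring.
by rewrite e1 e2 !mulr1.
Qed.

(** Each trapezoid is the triangle spanned with the centre, r^2 sin phi cos phi, plus the increment
    of x y / 2, which telescopes to 0. The diameter contributes nothing, its endpoints having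
    opposite abscissas. *)
Lemma area_inscribed :
  signed_area inscribed = r ^+ 2 * \sum_(i < 6) sin (phi i) * cos (phi i).
Proof.
rewrite /signed_area big_ord_recr.
have -> : ordS (ord_max : 'I_7) = ord0 by apply: val_inj.
have -> : (inscribed ord_max).1 + (inscribed ord0).1 = 0.
  by rewrite /inscribed /= angle0 angle6 cos0 cospi mulrN1 mulr1 addNr.
rewrite !mul0r; apply: etrans (addr0 _) _.
pose xy k := r ^+ 2 * cos (angle k) * sin (angle k) / 2.
have step (i : 'I_6) :
    ((inscribed (widen_ord (leqnSn 6) i)).1 + (inscribed (ordS (widen_ord (leqnSn 6) i))).1) / 2 *
    ((inscribed (ordS (widen_ord (leqnSn 6) i))).2 - (inscribed (widen_ord (leqnSn 6) i)).2) =
    r ^+ 2 * (sin (phi i) * cos (phi i)) + (xy i.+1 - xy i).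
  have -> : widen_ord (leqnSn 6) i = lift ord_max i.
    by apply: val_inj; rewrite /= /bump leqNgt ltn_ord.
  rewrite /inscribed /xy ordS_lift_max lift_max_val /= angleS !rot.
  have := cos2Dsin2 (angle i); have := cos2Dsin2 (phi i).
  move: (cos (angle i)) (sin (angle i)) (cos (phi i)) (sin (phi i)) => c s C S e1 e2.
  pose xy' a b := r ^+ 2 * a * b / 2.
  transitivity (r ^+ 2 * (S * C) * (c ^+ 2 + s ^+ 2) + (xy' (c * (1 - 2 * S ^+ 2) - s * (2 * S * C)) (s * (1 - 2 * S ^+ 2) + c * (2 * S * C)) - xy' c s)).
    by rewrite /xy'; field.
  by rewrite e2 mulr1 /xy'.
under eq_bigr do rewrite step.
rewrite big_split /= -mulr_sumr -(big_mkord xpredT (fun i => xy i.+1 - xy i)).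
rewrite telescope_sumr // /xy angle0 angle6 sinpi sin0 !mulr0 !mul0r subrr addr0.
by [].
Qed.

Lemma inscribed_common_root :
  let e k : R := meval (fun i => 4 * r ^+ 2 * sin (phi i) ^+ 2) (mesym 6 R k) in
  let u := - 4 * signed_area inscribed ^+ 2 in
  exists y s, [/\ Fval y u s e = 0, Gval y u s e = 0 & s ^+ 2 = - (u * e 6%N)].
Proof.
move=> e u; pose c i := cos (phi i); pose s i := sin (phi i).
have circ i : c i ^+ 2 + s i ^+ 2 = 1 by exact: cos2Dsin2.
pose psi i j := phi i + phi j.
have reE i j : pair_re c s i j = cos (psi i j) by rewrite cosD.
have imE i j : pair_im c s i j = sin (psi i j) by rewrite sinD addrC.
have tot : psi (inord 0) (inord 1) + psi (inord 2) (inord 3) + psi (inord 4) (inord 5) = pi / 2.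
  by rewrite -sum_phi big_inord6.
have cosB (a b : R) : a + b = pi / 2 -> cos a = sin b.
  by move=> ab; rewrite -cosBpihalf -ab opprD addrCA subrr addr0 cosN.
have sinB (a b : R) : a + b = pi / 2 -> sin a = cos b.
  by move=> ab; rewrite -(cosB b a) // addrC.
have [||h1 h2 h3] := @semicyclic_common_root R (r ^+ 2) c s circ.
- by rewrite !reE !imE -cosD; apply: cosB; rewrite addrC addrA.
- by rewrite !reE !imE -sinD; apply: sinB; rewrite addrC addrA.
move: h1 h2 h3; rewrite (@hb2E _ _ _ _ circ); first last.
- by rewrite !reE !imE -sinD; apply: sinB.
- by rewrite !reE !imE -sinD; apply: sinB; rewrite addrAC.
- by rewrite !reE !imE -sinD; apply: sinB; rewrite addrC addrA.
- by rewrite !reE !imE -cosD; apply: cosB.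
- by rewrite !reE !imE -cosD; apply: cosB; rewrite addrAC.
- by rewrite !reE !imE -cosD; apply: cosB; rewrite addrC addrA.
have -> : - (- 2 * r ^+ 2 * \sum_(i < 6) s i * c i) ^+ 2 = u.
  by rewrite /u area_inscribed -/(s _) -/(c _); ring.
by move=> h1 h2 h3; do 2!eexists; split; [exact: h1|exact: h2|exact: h3].
Qed.

End InscribedPolygon.

(** The area is nonzero because every sin phi cos phi is nonnegative and a short side makes it
    positive; this allows u_2^12 to be cancelled from N. *)
Lemma exists_semicyclic (R : realType) (x : 'I_6 -> R) :
  1 <= x ord0 -> (forall i, i != ord0 -> 0 < x i < 1) ->
  exists v : 'I_7 -> R * R,
    [/\ semicyclic v ord_max, forall i, side_length v (lift ord_max i) ^+ 2 = x i,
        signed_area v != 0 &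
        let e k : R := meval x (mesym 6 R k) in
        let u := - 4 * signed_area v ^+ 2 in
        exists y s, [/\ Fval y u s e = 0, Gval y u s e = 0 & s ^+ 2 = - (u * e 6%N)]].
Proof.
move=> x0 xi; have [phi [r [[r0 sphi rs s0 c0] c0']]] := exists_angles x0 xi.
exists (inscribed phi r); split.
- exact: inscribed_semicyclic.
- by move=> i; rewrite side_inscribed.
- rewrite area_inscribed // mulf_neq0 ?expf_neq0 ?gt_eqF //.
  have sc0 (i : 'I_6) : 0 <= sin (phi i) * cos (phi i) by rewrite mulr_ge0 ?(ltW (s0 i)).
  rewrite (bigD1 ord_max) //= ltr_wpDr ?sumr_ge0 // mulr_gt0 //.
  by apply: c0'.
have [y [s [h1 h2 h3]]] := inscribed_common_root r sphi.
have ext k : meval (fun i => 4 * r ^+ 2 * sin (phi i) ^+ 2) (mesym 6 R k) = meval x (mesym 6 R k).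
  exact: meval_eq.
exists y, s; rewrite -(eq_Fval ext) -(eq_Gval ext) -ext.
by split.
Qed.

(** * Ring morphisms and elementary symmetric polynomials *)

Lemma rmorph_mpoly_int n (S : comNzRingType) (phi : {rmorphism mpoly n int -> S}) p :
  phi p = mmap intr (fun i => phi (mpolyX int (mnm1 i))) p.
Proof.
rewrite {1}(mpolyE p) rmorph_sum /mmap; apply: eq_bigr => m _ /=.
rewrite -mul_mpolyC rmorphM /=; congr (_ * _).
  by have := rmorph_int (phi \o @mpolyC n int) (mcoeff m p); rewrite /= intz.
rewrite mpolyXE_id rmorph_prod; apply: eq_bigr => i _; exact: rmorphXn.
Qed.

Lemma eq_rmorph_mpoly_int n (S : comNzRingType) (phi psi : {rmorphism mpoly n int -> S}) :
  (forall i, phi (mpolyX int (mnm1 i)) = psi (mpolyX int (mnm1 i))) -> phi =1 psi.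
Proof.
move=> e p; rewrite (rmorph_mpoly_int phi) (rmorph_mpoly_int psi); apply: eq_bigr => m _.
by congr (_ * _); apply: mmap1_eq.
Qed.

Lemma meval_mesymE (A : comNzRingType) n (x : 'I_n -> A) k :
  meval x (mesym n A k) = \sum_(h : {set 'I_n} | #|h| == k) \prod_(i in h) x i.
Proof.
rewrite /mesym raddf_sum; apply: eq_bigr => h _ /=.
by rewrite rmorph_prod; apply: eq_bigr => i _; apply: mevalXU.
Qed.

Lemma meval_mesym_morph (A B : comNzRingType) (f : {rmorphism A -> B}) n (x : 'I_n -> A) k :
  f (meval x (mesym n A k)) = meval (f \o x) (mesym n B k).
Proof.
by rewrite !meval_mesymE rmorph_sum; apply: eq_bigr => h _; rewrite rmorph_prod.
Qed.

Lemma map_mesym (A B : comNzRingType) (f : {rmorphism A -> B}) n k :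
  map_mpoly f (mesym n A k) = mesym n B k.
Proof.
rewrite /mesym raddf_sum; apply: eq_bigr => h _ /=.
by rewrite rmorph_prod; apply: eq_bigr => i _; apply: map_mpolyX.
Qed.

Lemma map_uhom (A B : comNzRingType) (f : {rmorphism A -> B}) (e : nat -> A) (e' : nat -> B) p :
  (forall k, (0 < k < 7)%N -> f (e k) = e' k) -> map_poly f (uhom e p) = uhom e' p.
Proof.
move=> fe; rewrite -[LHS]/((map_poly f \o uhom e) p); apply: eq_rmorph_mpoly_int => i.
rewrite /= !mmapX !mmap1U /uvar; case: eqP => [_|/eqP i0]; first by rewrite map_polyX.
rewrite map_polyC /= fe // ltn_ord andbT lt0n.
by rewrite -val_eqE in i0.
Qed.

(** Residues of a_1^2, ..., a_6^2 whose elementary symmetric functions are [cert_sigma]: the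
    certificate has to come from side values, since these are what is specialised. *)
Definition cert_a (i : 'I_6) : nat := nth 0%N [:: 6; 11; 19; 26; 28; 29]%N i.

Lemma cert_sigmaE k : (0 < k < 7)%N ->
  meval (fun i => (cert_a i)%:R) (mesym 6 'F_31 k) = (cert_sigma k)%:R.
Proof.
move=> /andP[k0 k7]; rewrite mesym_coef //.
have char31 : 31%:R = 0 :> {poly 'F_31}.
  by rewrite -polyC_natr (pcharf0 (pchar_Fp _)).
pose mulX c l := ladd (lscale c l) (0%N :: l).
have mulXE c l : leval 'X (mulX c l) = ('X + c%:R%:P) * leval 'X l :> {poly 'F_31}.
  by rewrite leval_add // leval_scale // /= add0r polyC_natr; ring.
have -> : \prod_(i < 6) ('X + (cert_a i)%:R%:P) =
    leval 'X (mulX 6 (mulX 11 (mulX 19 (mulX 26 (mulX 28 (mulX 29 [:: 1]))))))%N :> {poly 'F_31}.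
  rewrite !mulXE !big_ord_recl big_ord0 /= mulr0 addr0.
  by rewrite /cert_a /= /bump.
rewrite -['X]scale1r coef_leval expr1n mulr1.
case: k k0 k7 => [|[|[|[|[|[|[|]]]]]]] // _ _; by vm_compute.
Qed.

(** * Comparison with alpha'_6 *)

Lemma clear_denominators n (q : mpoly n rat) : exists (N : nat) (q' : mpoly n int),
  (0 < N)%N /\ map_mpoly intr q' = mpolyC n N%:R * q.
Proof.
rewrite [q]mpolyE; elim/big_ind: _ => [|p r [N [p' [N0 pE]]] [M [r' [M0 rE]]]|m _].
- by exists 1%N, 0; rewrite mulr0 rmorph0.
- exists (N * M)%N, (mpolyC n M%:R * p' + mpolyC n N%:R * r').
  rewrite muln_gt0 N0 M0; split=> //.
  rewrite natrM mpolyCM rmorphD !(rmorphM (map_mpoly _)) /= pE rE !map_mpolyC /= !rmorph_nat; ring.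
- set c := mcoeff m q; exists `|denq c|%N, (mpolyC n (numq c) * mpolyX int m).
  rewrite absz_gt0 denq_neq0; split=> //.
  rewrite rmorphM /= map_mpolyC map_mpolyX -mul_mpolyC mulrA -mpolyCM.
  congr (mpolyC n _ * _); rewrite pmulrn absz_denq /=.
  by rewrite -{3}[c]divq_num_den mulrC divfK // intr_eq0 denq_neq0.
Qed.

Lemma unit_mpolyC n (R : idomainType) (q r : mpoly n R) :
  q * r = 1 -> exists c, q = mpolyC n c.
Proof.
move=> qr; exists (mcoeff (@mnm0 n) q); apply: msize1_polyC.
have q0 : q != 0 by apply: contra_eq_neq qr => ->; rewrite mul0r eq_sym oner_eq0.
have r0 : r != 0 by apply: contra_eq_neq qr => ->; rewrite mulr0 eq_sym oner_eq0.
have := msizeM q0 r0; rewrite qr msize1.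
by move: q0 r0; rewrite -!msize_poly_eq0; move: (mmeasure _ q) (mmeasure _ r) => a b; lia.
Qed.

Lemma mpoly_Fp_eq0 n p (q : mpoly n int) : prime p ->
  map_mpoly (intr : int -> 'F_p) q = 0 -> exists q', q = mpolyC n p%:R * q'.
Proof.
move=> p_pr q0.
exists (\sum_(m <- msupp q) (mcoeff m q %/ p)%Z *: mpolyX int m).
rewrite mulr_sumr {1}(mpolyE q); apply: eq_bigr => m _.
rewrite mul_mpolyC scalerA; congr (_ *: _).
have := congr1 (mcoeff m) q0; rewrite mcoeff_map_mpoly mcoeff0 => /eqP.
rewrite -(dvdz_pcharf (pchar_Fp p_pr)) => /divzK {1}<-.
by rewrite mulrC natz.
Qed.

(** Primes are removed from N one at a time: modulo p the product q r vanishes in a domain, so p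
    divides q or r. At N = 1 the irreducibility of [al] applies. *)
Lemma gauss_factor n (al : mpoly n int) N (q r : mpoly n int) :
  irreducible_elt al -> (0 < N)%N -> mpolyC n N%:R * al = q * r ->
  (exists c, q = mpolyC n c) \/ (exists c, r = mpolyC n c).
Proof.
move=> [_ _ irr]; elim/ltn_ind: N q r => N IH q r N0 qr.
have [N1|N1] := leqP N 1.
  move: qr; have -> : N = 1%N by lia.
  rewrite mpolyC1 mul1r => /irr [] /unitrP [z [z1 z2]].
    by left; apply: unit_mpolyC z2.
  by right; apply: unit_mpolyC z2.
have p_pr := pdiv_prime N1; set p := pdiv N in p_pr.
have /dvdnP [M NM] := pdiv_dvd N; rewrite -/p in NM.
have p0 : p%:R != 0 :> int by rewrite pnatr_eq0 -lt0n prime_gt0.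
have M0 : (0 < M)%N by lia.
have MN : (M < N)%N by rewrite NM ltn_Pmulr // prime_gt1.
have cancel (a b : mpoly n int) : mpolyC n p%:R * a = mpolyC n p%:R * b -> a = b.
  by apply: mulfI; rewrite mpolyC_eq0.
have scale q1 : (exists c, q1 = mpolyC n c) -> exists c, mpolyC n p%:R * q1 = mpolyC n c.
  by move=> [c ->]; exists (p%:R * c); rewrite mpolyCM.
have /eqP : map_mpoly (intr : int -> 'F_p) q * map_mpoly intr r = 0.
  have p0' : (p%:R : int)%:~R = 0 :> 'F_p.
    by rewrite rmorph_nat (pcharf0 (pchar_Fp p_pr)).
  rewrite -rmorphM -qr NM natrM mpolyCM mulrAC mulrC (rmorphM (map_mpoly _)) /=.
  by rewrite map_mpolyC /= p0' mpolyC0 mul0r.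
rewrite mulf_eq0 => /orP[] /eqP /(mpoly_Fp_eq0 p_pr) [q1 qE].
  have qr1 : mpolyC n M%:R * al = q1 * r.
    by apply: cancel; rewrite [RHS]mulrA -qE -qr NM natrM mpolyCM; ring.
  case: (IH M MN q1 r M0 qr1) => h; last by right.
  by left; rewrite qE; apply: scale.
have qr1 : mpolyC n M%:R * al = q * q1.
  by apply: cancel; rewrite [RHS]mulrCA -qE -qr NM natrM mpolyCM; ring.
case: (IH M MN q q1 M0 qr1) => h; first by left.
by right; rewrite qE; apply: scale.
Qed.

Lemma gauss_rat n (al : mpoly n int) (q r : mpoly n rat) :
  irreducible_elt al -> map_mpoly intr al = q * r ->
  (exists c, q = mpolyC n c) \/ (exists c, r = mpolyC n c).
Proof.
move=> irr qr; have [N [q' [N0 qE]]] := clear_denominators q.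
have [M [r' [M0 rE]]] := clear_denominators r.
have const k (p : mpoly n rat) p' : (0 < k)%N -> map_mpoly intr p' = mpolyC n k%:R * p ->
    (exists c, p' = mpolyC n c) -> exists c, p = mpolyC n c.
  move=> k0 pE [c p'E]; exists (c%:~R / k%:R).
  have k0' : k%:R != 0 :> rat by rewrite pnatr_eq0 -lt0n.
  apply: (@mulfI _ (mpolyC n k%:R)); first by rewrite mpolyC_eq0.
  by rewrite -pE p'E map_mpolyC /= -mpolyCM mulrC divfK.
have NM0 : (0 < N * M)%N by rewrite muln_gt0 N0.
have := @gauss_factor n al (N * M) q' r' irr NM0.
case.
- apply/mpolyP => m; apply: (@intr_inj rat); rewrite /= -!mcoeff_map_mpoly.
  rewrite natrM mpolyCM !(rmorphM (map_mpoly _)) /= qr qE rE !map_mpolyC /= !rmorph_nat.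
  by congr (mcoeff m); ring.
- by left; apply: const qE _.
- by right; apply: const rE _.
Qed.

Lemma eq_in_Fval (R : comNzRingType) (y u s : R) (e e' : nat -> R) :
  (forall k, (0 < k < 7)%N -> e k = e' k) -> Fval y u s e = Fval y u s e'.
Proof. by move=> ee'; rewrite /Fval /T3 /T4 /T2 /T1 /= !ee'. Qed.

Lemma eq_in_Gval (R : comNzRingType) (y u s : R) (e e' : nat -> R) :
  (forall k, (0 < k < 7)%N -> e k = e' k) -> Gval y u s e = Gval y u s e'.
Proof. by move=> ee'; rewrite /Gval /T3 /T5 /T2 /T1 /= !ee'. Qed.

(** * Divisibility of alpha'_6 by P over Q[a_1^2, ..., a_6^2] *)

Notation Qa := (mpoly 6 rat).

(** Views a polynomial in 16 K^2 and the a_i^2 as one in u_2 over Q[a_1^2, ..., a_6^2], with 16 K^2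
    = -4 u_2. *)
Definition ahat : {rmorphism mpoly 7 int -> {poly Qa}} :=
  mmap (polyC \o (@mpolyC 6 rat \o (intr : int -> rat)))
    (fun j : 'I_7 => if unlift ord0 j is Some i then (mpolyX rat (mnm1 i))%:P
                     else - 4 *: 'X).

Lemma ahatX0 : ahat (mpolyX int (mnm1 ord0)) = - 4 *: 'X.
Proof. by rewrite /ahat /= mmapX mmap1U unlift_none. Qed.

Lemma ahatX (i : 'I_6) : ahat (mpolyX int (mnm1 (lift ord0 i))) = (mpolyX rat (mnm1 i))%:P.
Proof. by rewrite /ahat /= mmapX mmap1U liftK. Qed.

Definition Phat (P : Zus) : {poly Qa} := uhom (fun k => mesym 6 rat k) P.

Section RealPoints.
Variables (R : realType) (P : Zus) (al : mpoly 7 int).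
Hypothesis PE : Znorm Dres = P * zu2 ^+ 12.
Hypothesis al0 : vanishes_on_semicyclic R al.

Let evR (x : 'I_6 -> R) : {rmorphism Qa -> R} := meval x \o map_mpoly (ratr : rat -> R).

Lemma common_zero (x : 'I_6 -> R) :
  1 <= x ord0 -> (forall i, i != ord0 -> 0 < x i < 1) ->
  exists u : R, (map_poly (evR x) (ahat al)).[u] = 0 /\ (map_poly (evR x) (Phat P)).[u] = 0.
Proof.
move=> x0 xi; have [v [semi sides area0 [y [s [Fy Gy s2]]]]] := exists_semicyclic x0 xi.
set u := - 4 * signed_area v ^+ 2 in Fy Gy s2; exists u; split.
  pose lhs : {rmorphism mpoly 7 int -> R} :=
    horner_eval u \o (map_poly (evR x) \o ahat).
  have lhsE p : lhs p = (map_poly (evR x) (ahat p)).[u] by [].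
  rewrite -[LHS]lhsE -[RHS](al0 semi).
  set w := (X in meval X).
  pose rhs : {rmorphism mpoly 7 int -> R} := meval w \o map_mpoly (intr : int -> R).
  rewrite -[RHS]/(rhs al); apply: eq_rmorph_mpoly_int => j.
  have -> : rhs (mpolyX int (mnm1 j)) = w j by rewrite /rhs /= map_mpolyX mevalXU.
  rewrite [LHS]lhsE {lhs lhsE rhs}.
  have [i ->|->] := unliftP ord0 j.
    by rewrite ahatX map_polyC hornerC /w liftK /evR /= map_mpolyX mevalXU sides.
  rewrite ahatX0 map_polyZ map_polyX hornerZ hornerX /w unlift_none rmorphN rmorph_nat.
  by rewrite /u; ring.
pose psi : {rmorphism Zus -> R} :=
  horner_eval u \o (map_poly (evR x) \o uhom (fun k => mesym 6 rat k)).
have psiE p : psi p = (map_poly (evR x) (uhom (fun k => mesym 6 rat k) p)).[u] by [].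
rewrite /Phat -psiE.
have psi_u : psi zu2 = u by rewrite psiE uhom_u2 map_polyX hornerX.
have psi_s k : (0 < k < 7)%N -> (psi \o zsigma) k = meval x (mesym 6 R k).
  move=> k7; rewrite [LHS]psiE uhom_sigma // map_polyC hornerC /=.
  by rewrite map_mesym.
have u0 : u != 0 by rewrite mulf_neq0 ?oppr_eq0 ?pnatr_eq0 ?expf_neq0.
have s2' : s ^+ 2 = - (psi zu2 * psi (zsigma 6)).
  by rewrite psi_u -[psi (zsigma 6)]/((psi \o zsigma) 6%N) psi_s.
have Fy' : Fval y (psi zu2) s (psi \o zsigma) = 0.
  by rewrite psi_u (eq_in_Fval _ _ _ psi_s).
have Gy' : Gval y (psi zu2) s (psi \o zsigma) = 0.
  by rewrite psi_u (eq_in_Gval _ _ _ psi_s).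
have := morph_Znorm Dres s2'; rewrite (Dres_common_root Fy' Gy') mul0r PE.
have psiM (p q : Zus) k : psi (p * q ^+ k) = psi p * psi q ^+ k.
  by rewrite rmorphM rmorphXn.
rewrite psiM psi_u => /eqP; rewrite mulf_eq0 expf_eq0 (negbTE u0) andbF orbF.
by move=> /eqP.
Qed.

Lemma dense_real_points (h : Qa) :
  (forall x : 'I_6 -> R, 1 <= x ord0 -> (forall i, i != ord0 -> 0 < x i < 1) ->
     evR x h = 0) -> h = 0.
Proof.
move=> h0; suff : map_mpoly (ratr : rat -> R) h = 0.
  move=> e; apply/mpolyP => m; apply: (fmorph_inj (ratr : {rmorphism rat -> R})).
  by have := congr1 (mcoeff m) e; rewrite /= mcoeff_map_mpoly !mcoeff0 rmorph0.
(* A grid inside the region: positive integers for the long side squared, 1/2, 1/3, ... for the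
   others. *)
pose e (i : 'I_6) (k : nat) : R := if i == ord0 then k.+1%:R else k.+2%:R^-1.
apply: (@mpoly_eq0_dense _ _ _ e) => [i j k /eqP|k].
  rewrite /e; case: ifP => _; first by rewrite eqr_nat eqSS => /eqP.
  by rewrite (inj_eq invr_inj) eqr_nat !eqSS => /eqP.
apply: h0; first by rewrite /e eqxx ler1n.
move=> i i0; rewrite /e (negbTE i0) invr_gt0 ltr0n /=.
by rewrite invf_lt1 ?ltr0n // ltr1n.
Qed.

End RealPoints.

Section Division.
Variable R : realType.

Let evR (x : 'I_6 -> R) : {rmorphism Qa -> R} := meval x \o map_mpoly (ratr : rat -> R).
Let evQ (x : 'I_6 -> rat) : {rmorphism Qa -> rat} := meval x.

(** Integer points congruent to [cert_a] modulo 31; they are Zariski dense and keep the certificate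
    valid. *)
Let point (k : 'I_6 -> nat) (i : 'I_6) : int := (cert_a i)%:R + 31 * (k i)%:R.

Lemma Phat_irreducible P k : Znorm Dres = P * zu2 ^+ 12 ->
  irreducible_poly (map_poly (evQ (fun i => (point k i)%:~R)) (Phat P)).
Proof.
move=> PE; pose e (j : nat) : int := meval (point k) (mesym 6 int j).
rewrite /Phat (map_uhom (e' := fun j => (e j)%:~R)) => [|j j7]; last first.
  by rewrite /e meval_mesym_morph [LHS]meval_mesymE [RHS]meval_mesymE.
rewrite -(map_uhom (f := intr : {rmorphism int -> rat}) (e := e)) //.
apply: uhom_irreducible => // j j7.
rewrite -cert_sigmaE // /e (meval_mesym_morph (intr : {rmorphism int -> 'F_31})).
apply: meval_eq => i; rewrite /= /point rmorphD rmorphM /= !rmorph_nat.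
by rewrite (pcharf0 (pchar_Fp _)) // mul0r addr0.
Qed.

Lemma dense_points (h : Qa) : (forall k, evQ (fun i => (point k i)%:~R) h = 0) -> h = 0.
Proof.
pose e i (j : nat) : rat := ((cert_a i)%:R + 31 * j%:R : int)%:~R.
move=> h0; apply: (@mpoly_eq0_dense _ _ _ e) => [i j j'|k]; last exact: h0.
by move=> /intr_inj; rewrite -!natrM -!natrD => /eqP; rewrite eqr_nat => /eqP; lia.
Qed.

(** The remainder r of q shares the common roots, so its resultant with p is zero identically. If
    the leading coefficient of r survived at an integer point, r would there have a common factor
    with the irreducible p although its degree is smaller. Hence that coefficient vanishes on a
    dense set. *)
Lemma dvdp_of_common_zeros (p q : {poly Qa}) :
  lead_coef p \is a GRing.unit -> (1 < size p)%N ->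
  (forall k, irreducible_poly (map_poly (evQ (fun i => (point k i)%:~R)) p)) ->
  (forall x : 'I_6 -> R, 1 <= x ord0 -> (forall i, i != ord0 -> 0 < x i < 1) ->
     exists u, (map_poly (evR x) q).[u] = 0 /\ (map_poly (evR x) p).[u] = 0) ->
  exists Q, q = p * Q.
Proof.
move=> up sp irr common; have E := Pdiv.IdomainUnit.divp_eq up q.
have sr : (size (q %% p)%R < size p)%N.
  by rewrite ltn_modpN0 // -size_poly_gt0 (leq_trans _ sp).
move: E sr; move: (q %/ p)%R (q %% p)%R => Q r E sr.
exists Q; suff r0 : r = 0 by rewrite E r0 addr0 mulrC.
(* [resultant_in_ideal] requires nonconstant arguments; a constant remainder serves as its own test
   value. *)
pose h := if (1 < size r)%N then resultant p r else r`_0.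
have h0 : h = 0.
  apply: dense_real_points => x x0 xi; have [u [qu pu]] := common x x0 xi.
  have ru : (map_poly (evR x) r).[u] = 0.
    by move: qu; rewrite E rmorphD rmorphM hornerD hornerM pu mulr0 add0r.
  rewrite /h; case: ifPn => sr1.
    have [[a b] _ /= ab] := resultant_in_ideal sp sr1.
    have := congr1 (fun t => (map_poly (evR x) t).[u]) ab.
    by rewrite /= map_polyC hornerC rmorphD !rmorphM hornerD !hornerM pu ru !mulr0 addr0.
  by move: ru; rewrite -leqNgt in sr1; rewrite (size1_polyC sr1) map_polyC hornerC coefC.
move: h0; rewrite /h; case: ifPn => [sr1 res0|]; last first.
  by rewrite -leqNgt => sr1 r0; rewrite (size1_polyC sr1) r0 polyC0.
apply/eqP; rewrite -lead_coef_eq0; apply/eqP/dense_points => k.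
apply/eqP/idPn => rk; set f := evQ _ in rk.
have pk : f (lead_coef p) != 0 by rewrite -unitfE; apply: rmorph_unit.
have := irr k; rewrite -/f => - [_ /(_ (gcdp (map_poly f p) (map_poly f r)))].
rewrite neq_ltn -resultant_eq0 -resultant_map // res0 rmorph0 eqxx orbT dvdp_gcdl.
move=> /(_ isT isT) /andP[_ /dvdp_trans /(_ (dvdp_gcdr _ _)) /dvdp_leq].
rewrite -size_poly_gt0 !size_map_poly_id0 // (ltnW sr1) => /(_ isT).
by rewrite leqNgt sr.
Qed.

Lemma Phat_top P : Znorm Dres = P * zu2 ^+ 12 -> has_top 30 (2%:R ^+ 196) (Phat P).
Proof. by move=> PE; apply: top_uhom_P. Qed.

Lemma unit_exp2 k : (2%:R ^+ k : Qa) \is a GRing.unit.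
Proof.
by rewrite unitrX // -mpolyC_nat; apply: (rmorph_unit (@mpolyC 6 rat)); rewrite unitfE pnatr_eq0.
Qed.

Lemma Phat_lead P : Znorm Dres = P * zu2 ^+ 12 ->
  size (Phat P) = 31%N /\ lead_coef (Phat P) = 2%:R ^+ 196.
Proof.
move=> PE; apply: (has_top_lead _ (Phat_top PE)).
by apply: contraTneq (unit_exp2 196) => ->; rewrite unitr0.
Qed.

Lemma dvdp_Phat_ahat P al : Znorm Dres = P * zu2 ^+ 12 ->
  vanishes_on_semicyclic R al -> exists Q, ahat al = Phat P * Q.
Proof.
move=> PE al0; have [sP lP] := Phat_lead PE.
apply: dvdp_of_common_zeros; first by rewrite lP; apply: unit_exp2.
- by rewrite sP.
- by move=> k; apply: Phat_irreducible.
- by move=> x; apply: common_zero.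
Qed.

End Division.

Lemma rmorph_mpoly n (R : nzRingType) (S : comNzRingType) (phi : {rmorphism mpoly n R -> S}) p :
  phi p = mmap (phi \o @mpolyC n R) (fun i => phi (mpolyX R (mnm1 i))) p.
Proof.
rewrite {1}(mpolyE p) rmorph_sum /mmap; apply: eq_bigr => m _ /=.
rewrite -mul_mpolyC rmorphM /=; congr (_ * _).
rewrite mpolyXE_id rmorph_prod; apply: eq_bigr => i _; exact: rmorphXn.
Qed.

Lemma eq_rmorph_mpoly n (R : nzRingType) (S : comNzRingType) (phi psi : {rmorphism mpoly n R -> S}) :
  (forall c, phi (mpolyC n c) = psi (mpolyC n c)) ->
  (forall i, phi (mpolyX R (mnm1 i)) = psi (mpolyX R (mnm1 i))) -> phi =1 psi.
Proof.
move=> eC eX p; rewrite (rmorph_mpoly phi) (rmorph_mpoly psi); apply: eq_bigr => m _.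
by congr (_ * _); [apply: eC | apply: mmap1_eq].
Qed.

(** * Separating the first variable and determining the constant factor *)

Section FirstVariable.
Variables (n : nat) (K : comNzRingType).

Definition split_first : {rmorphism mpoly n.+1 K -> {poly mpoly n K}} :=
  mmap (polyC \o @mpolyC n K)
    (fun j => if unlift ord0 j is Some i then (mpolyX K (mnm1 i))%:P else 'X).

Definition lift_vars : {rmorphism mpoly n K -> mpoly n.+1 K} :=
  comp_mpoly [tuple mpolyX K (mnm1 (lift ord0 i)) | i < n].

(** Inverse of [split_first] when v is X_0; a general v also permits -X_0/4, which undoes the
    substitution of -4 u_2 for 16 K^2. *)
Definition merge_first (v : mpoly n.+1 K) : {rmorphism {poly mpoly n K} -> mpoly n.+1 K} :=
  horner_eval v \o map_poly lift_vars.

Lemma split_firstC c : split_first (mpolyC n.+1 c) = (mpolyC n c)%:P.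
Proof. by rewrite /split_first /= mmapC. Qed.

Lemma split_first0 : split_first (mpolyX K (mnm1 ord0)) = 'X.
Proof. by rewrite /split_first /= mmapX mmap1U unlift_none. Qed.

Lemma split_firstX i : split_first (mpolyX K (mnm1 (lift ord0 i))) = (mpolyX K (mnm1 i))%:P.
Proof. by rewrite /split_first /= mmapX mmap1U liftK. Qed.

Lemma lift_varsC c : lift_vars (mpolyC n c) = mpolyC n.+1 c.
Proof. exact: comp_mpolyC. Qed.

Lemma lift_varsX i : lift_vars (mpolyX K (mnm1 i)) = mpolyX K (mnm1 (lift ord0 i)).
Proof. by rewrite /lift_vars /= comp_mpolyXU -tnth_nth tnth_mktuple. Qed.

Lemma merge_firstC v c : merge_first v c%:P = lift_vars c.
Proof. by rewrite /merge_first /= /horner_eval map_polyC hornerC. Qed.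

Lemma merge_firstX v : merge_first v 'X = v.
Proof. by rewrite /merge_first /= /horner_eval map_polyX hornerX. Qed.

Lemma split_lift_vars p : split_first (lift_vars p) = p%:P.
Proof.
rewrite -[LHS]/((split_first \o lift_vars) p) -[RHS]/((polyC : {rmorphism _ -> _}) p).
apply: eq_rmorph_mpoly => [c|i] /=; first by rewrite lift_varsC split_firstC.
by rewrite lift_varsX split_firstX.
Qed.

Lemma split_firstK p : merge_first (mpolyX K (mnm1 ord0)) (split_first p) = p.
Proof.
pose phi : {rmorphism _ -> _} := merge_first (mpolyX K (mnm1 ord0)) \o split_first.
have phiE q : phi q = merge_first (mpolyX K (mnm1 ord0)) (split_first q) by [].
rewrite -phiE; apply: (@eq_rmorph_mpoly _ _ _ phi idfun) => [c|i]; rewrite [LHS]phiE [RHS]/=.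
  by rewrite split_firstC merge_firstC lift_varsC.
have [j ->|->] := unliftP ord0 i; last by rewrite split_first0 merge_firstX.
by rewrite split_firstX merge_firstC lift_varsX.
Qed.

Lemma eq_rmorph_poly (A : comNzRingType) (phi psi : {rmorphism {poly mpoly n K} -> A}) :
  (forall c, phi c%:P = psi c%:P) -> phi 'X = psi 'X -> phi =1 psi.
Proof.
move=> eC eX p; rewrite -[p]coefK poly_def !rmorph_sum; apply: eq_bigr => i _.
by rewrite -mul_polyC !(rmorphM phi, rmorphM psi, rmorphXn phi, rmorphXn psi) /= eC eX.
Qed.

Lemma size_split_first p d :
  (forall m, m \in msupp p -> (m ord0 < d)%N) -> (size (split_first p) <= d)%N.
Proof.
move=> pd; rewrite /split_first /= /mmap big_seq.
apply: (leq_trans (size_sum _ _ _)); apply/bigmax_leqP_seq => m _ /pd md.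
have -> : mmap1 (fun j : 'I_n.+1 =>
    if unlift ord0 j is Some i then (mpolyX K (mnm1 i))%:P else 'X) m =
  (\prod_(i < n) mpolyX K (mnm1 i) ^+ m (lift ord0 i))%:P * 'X^(m ord0).
  rewrite /mmap1 big_ord_recl /= unlift_none mulrC rmorph_prod; congr (_ * _).
  by apply: eq_bigr => i _; rewrite liftK rmorphXn.
rewrite /= mulrA -polyCM mul_polyC.
by rewrite (leq_trans (size_scale_leq _ _)) // size_polyXn.
Qed.

End FirstVariable.

Lemma ahatE al : ahat al = split_first 6 rat (map_mpoly intr al) \Po (- 4 *: 'X).
Proof.
pose phi : {rmorphism mpoly 7 int -> {poly Qa}} :=
  comp_poly (- 4 *: 'X) \o (split_first 6 rat \o map_mpoly (intr : int -> rat)).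
have phiE p : phi p = split_first 6 rat (map_mpoly intr p) \Po (- 4 *: 'X) by [].
rewrite -phiE; apply: eq_rmorph_mpoly_int => j; rewrite [RHS]phiE map_mpolyX.
have [i ->|->] := unliftP ord0 j; first by rewrite ahatX split_firstX comp_polyC.
by rewrite ahatX0 split_first0 comp_polyX.
Qed.

Lemma coef_scale_var (A : comNzRingType) (c : A) p k : (p \Po (c *: 'X))`_k = c ^+ k * p`_k.
Proof.
rewrite comp_polyE; under eq_bigr do rewrite exprZn scalerA.
rewrite -(poly_def (size p) (fun i => p`_i * c ^+ i)) coef_poly mulrC.
by case: ltnP => // /leq_sizeP/(_ _ (leqnn _)) ->; rewrite mulr0.
Qed.

(** The factorisation is carried back to seven variables, where [gauss_rat] makes one factor
    constant; it cannot be p, whose degree in u_2 is positive. *)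
Lemma ahat_scale al (p q : {poly Qa}) :
  irreducible_elt al -> (1 < size p)%N -> ahat al = p * q ->
  exists c : rat, ahat al = mpolyC 6 c *: p.
Proof.
move=> irr sp alE; pose w := mpolyC 7 (- 4^-1) * mpolyX rat (mnm1 ord0) : Qus.
pose back := merge_first w.
pose fwd : {rmorphism Qus -> {poly Qa}} := comp_poly (- 4 *: 'X) \o split_first 6 rat.
have fwdE a : fwd a = split_first 6 rat a \Po (- 4 *: 'X) by [].
have fwdC c : fwd (mpolyC 7 c) = (mpolyC 6 c)%:P.
  by rewrite fwdE split_firstC comp_polyC.
have fwd_back a : fwd (back a) = a.
  pose phi : {rmorphism {poly Qa} -> {poly Qa}} := fwd \o back.
  have phiE b : phi b = fwd (back b) by [].
  rewrite -phiE; apply: (@eq_rmorph_poly _ _ _ phi idfun) => [c|]; rewrite [LHS]phiE [RHS]/=.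
    by rewrite merge_firstC fwdE split_lift_vars comp_polyC.
  rewrite merge_firstX (rmorphM fwd) fwdC fwdE split_first0 comp_polyX mul_polyC.
  rewrite scalerA -mpolyC_nat -mpolyCN -mpolyCM.
  have -> : - 4^-1 * - 4 = 1 :> rat by field.
  by rewrite mpolyC1 scale1r.
have back_ahat : back (ahat al) = map_mpoly intr al.
  pose phi : {rmorphism mpoly 7 int -> Qus} := back \o ahat.
  have phiE b : phi b = back (ahat b) by [].
  rewrite -phiE; apply: eq_rmorph_mpoly_int => j; rewrite [LHS]phiE [RHS]map_mpolyX.
  have [i ->|->] := unliftP ord0 j; first by rewrite ahatX merge_firstC lift_varsX.
  rewrite ahatX0 -mul_polyC (rmorphM back) merge_firstC merge_firstX.
  rewrite (rmorphN (lift_vars 6 rat)) rmorph_nat mulrA.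
  rewrite -mpolyC_nat -mpolyCN -mpolyCM.
  have -> : - 4 * - 4^-1 = 1 :> rat by field.
  by rewrite mpolyC1 mul1r.
have factored : map_mpoly intr al = back p * back q by rewrite -back_ahat alE (rmorphM back).
have [[c pE]|[c qE]] := gauss_rat irr factored.
  by move: sp; rewrite -(fwd_back p) pE fwdC size_polyC; case: eqP.
by exists c; rewrite alE -(fwd_back q) qE fwdC mulrC mul_polyC.
Qed.

Lemma ahat_top al : monic_in_first al -> exists d, has_top d ((- 4) ^+ d) (ahat al).
Proof.
move=> [d [al1 ald]]; exists d; set top := mnm_muln _ d in al1 ald.
pose q := al - mpolyX int top.
have qd m : m \in msupp (map_mpoly (intr : int -> rat) q) -> (m ord0 < d)%N.
  rewrite mcoeff_msupp mcoeff_map_mpoly intr_eq0 mcoeffB mcoeffX.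
  case: (top =P m) => [<-|tm]; first by rewrite al1 subrr eqxx.
  by rewrite subr0 -mcoeff_msupp => mal; rewrite ltnNge; apply/negP => /(ald m mal) /esym.
have -> : ahat al = ahat q + (- 4) ^+ d *: 'X^d.
  have -> : (- 4) ^+ d *: 'X^d = ahat (mpolyX int top).
    have -> : mpolyX int top = mpolyX int (mnm1 ord0) ^+ d by rewrite mpolyXn.
    by rewrite (rmorphXn ahat) ahatX0 exprZn.
  by rewrite -(rmorphD ahat) subrK.
rewrite -[X in has_top d X]add0r; apply: has_topD.
  have sq : (size (ahat q) <= d)%N.
    apply/leq_sizeP => k dk; rewrite ahatE coef_scale_var.
    by have /leq_sizeP -> := size_split_first qd; rewrite ?mulr0.
  by split; [apply: leqW | apply: nth_default].
by split; [rewrite (leq_trans (size_scale_leq _ _)) ?size_polyXn | rewrite coefZ coefXn eqxx mulr1].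
Qed.

Lemma scale_of_top (c : rat) a b : ~~ odd a ->
  mpolyC 6 c * 2%:R ^+ (2 * a + b) = (- 4) ^+ a -> c = (2%:R ^+ b)^-1.
Proof.
move=> /negbTE even_a /(congr1 (mcoeff (@mnm0 6))).
rewrite -[2%:R]mpolyC_nat -[4%:R]mpolyC_nat -mpolyCN -!(rmorphXn (@mpolyC 6 rat)) -mpolyCM !mcoeffC eqxx !mulr1.
have -> : - 4%:R = - (2%:R ^+ 2) :> rat by [].
have two0 k : 2%:R ^+ k != 0 :> rat by rewrite expf_neq0.
rewrite exprNn -exprM exprD -signr_odd even_a.
rewrite mul1r mulrA mulrAC => e.
apply: (mulIf (two0 b)); rewrite mulVf //.
by apply: (mulIf (two0 (2 * a)%N)); rewrite e mul1r.
Qed.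

Lemma ahat_eq P al Q : Znorm Dres = P * zu2 ^+ 12 -> irreducible_elt al -> monic_in_first al ->
  ahat al = Phat P * Q -> ahat al = mpolyC 6 ((2%:R ^+ 136)^-1) *: Phat P.
Proof.
move=> PE irr monic alE; have [sP _] := Phat_lead PE; have topP := Phat_top PE.
have sP1 : (1 < size (Phat P))%N by rewrite sP.
have [c cE] := ahat_scale irr sP1 alE; 
suff <- : c = (2%:R ^+ 136)^-1 by [].
have [d topd] := ahat_top monic.
have four0 : (- 4) ^+ d != 0 :> Qa.
  by rewrite expf_neq0 // oppr_eq0 -mpolyC_nat mpolyC_eq0 pnatr_eq0.
have [sal lal] := has_top_lead four0 topd.
have c0 : c != 0.
  by apply/eqP => c0; move: sal; rewrite cE c0 mpolyC0 scale0r size_poly0.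
have d30 : d = 30%N.
  by move: sal; rewrite cE size_scale ?mpolyC_eq0 // sP => -[].
(* Comparison of leading coefficients in u_2: c 2^196 = (-4)^30 = 2^60. *)
apply: (@scale_of_top c 30 136); first by [].
have -> : (2 * 30 + 136 = 196)%N by [].
by rewrite -topP.2 -d30 -topd.2 cE coefZ d30.
Qed.

Lemma mpoly_intr_inj n : injective (map_mpoly (intr : int -> rat) : mpoly n int -> mpoly n rat).
Proof.
move=> p q e; apply/mpolyP => m; apply: (@intr_inj rat).
by have := congr1 (mcoeff m) e; rewrite /= !mcoeff_map_mpoly.
Qed.

Lemma split_first_map (p : mpoly 7 int) :
  split_first 6 rat (map_mpoly intr p) = map_poly (map_mpoly intr) (split_first 6 int p).
Proof.
pose phi : {rmorphism mpoly 7 int -> {poly Qa}} := split_first 6 rat \o map_mpoly (intr : int -> rat).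
pose psi : {rmorphism mpoly 7 int -> {poly Qa}} :=
  map_poly (map_mpoly (intr : int -> rat)) \o split_first 6 int.
have phiE q : phi q = split_first 6 rat (map_mpoly intr q) by [].
have psiE q : psi q = map_poly (map_mpoly intr) (split_first 6 int q) by [].
rewrite -phiE -psiE; apply: eq_rmorph_mpoly_int => j; rewrite [LHS]phiE [RHS]psiE map_mpolyX.
have [i ->|->] := unliftP ord0 j; last by rewrite !split_first0 map_polyX.
by rewrite !split_firstX map_polyC /= map_mpolyX.
Qed.

Lemma msym_map s (p : mpoly 6 int) :
  map_mpoly intr (msym s p) = msym s (map_mpoly (intr : int -> rat) p).
Proof.
pose phi : {rmorphism mpoly 6 int -> Qa} := map_mpoly (intr : int -> rat) \o msym s.
pose psi : {rmorphism mpoly 6 int -> Qa} := msym s \o map_mpoly (intr : int -> rat).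
rewrite -[LHS]/(phi p) -[RHS]/(psi p); apply: eq_rmorph_mpoly_int => i.
by rewrite /phi /psi /= map_mpolyX /msym !mmapX !mmap1U map_mpolyX.
Qed.

Lemma msym_Phat s P k : msym s (Phat P)`_k = (Phat P)`_k.
Proof.
rewrite -[LHS](coef_map (msym s : {rmorphism Qa -> Qa})) /Phat.
rewrite (map_uhom (e' := fun k => mesym 6 rat k)) // => j _.
exact: (issymP _ (mesym_sym 6 rat j)).
Qed.

(** Symmetry is inherited from [Phat P], whose coefficients are polynomials in the elementary
    symmetric ones. *)
Lemma split_first_sym P al c k : ahat al = mpolyC 6 c *: Phat P ->
  (split_first 6 int al)`_k \is symmetric.
Proof.
move=> alE; apply/issymP => s; apply: mpoly_intr_inj; rewrite msym_map.
have four0 : (- 4) ^+ k != 0 :> Qa.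
  by rewrite expf_neq0 // oppr_eq0 -mpolyC_nat mpolyC_eq0 pnatr_eq0.
have := congr1 (coefp k) alE; rewrite /= ahatE coef_scale_var split_first_map coef_map coefZ /= => E.
apply: (mulfI four0); have := congr1 (msym s) E.
rewrite !(rmorphM (msym s)) /= (rmorphXn (msym s)) rmorphN rmorph_nat => ->.
by rewrite E msym_Phat /msym mmapC.
Qed.

Definition esym_tuple (n : nat) (K : comNzRingType) := [tuple mesym n K i.+1 | i < n].

Definition sigma_hom : {rmorphism mpoly 7 int -> mpoly 7 int} :=
  comp_mpoly [tuple if j == ord0 then mpolyX int (mnm1 j) else @esym_sides 6 j | j < 7].

Lemma sigma_hom0 : sigma_hom (mpolyX int (mnm1 ord0)) = mpolyX int (mnm1 ord0).
Proof. by rewrite /sigma_hom /= comp_mpolyXU -tnth_nth tnth_mktuple eqxx. Qed.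

Lemma sigma_homX (i : 'I_6) :
  sigma_hom (mpolyX int (mnm1 (lift ord0 i))) = lift_vars 6 int (mesym 6 int i.+1).
Proof. by rewrite /sigma_hom /= comp_mpolyXU -tnth_nth tnth_mktuple. Qed.

Lemma sigma_hom_lift (q : mpoly 6 int) :
  sigma_hom (lift_vars 6 int q) = lift_vars 6 int (comp_mpoly (esym_tuple 6 int) q).
Proof.
pose phi : {rmorphism mpoly 6 int -> mpoly 7 int} := sigma_hom \o lift_vars 6 int.
pose psi : {rmorphism mpoly 6 int -> mpoly 7 int} := lift_vars 6 int \o comp_mpoly (esym_tuple 6 int).
have phiE p : phi p = sigma_hom (lift_vars 6 int p) by [].
have psiE p : psi p = lift_vars 6 int (comp_mpoly (esym_tuple 6 int) p) by [].
rewrite -phiE -psiE; apply: eq_rmorph_mpoly_int => i; rewrite [LHS]phiE [RHS]psiE.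
by rewrite lift_varsX sigma_homX comp_mpolyXU -tnth_nth tnth_mktuple.
Qed.

(** The fundamental theorem on symmetric polynomials, over Z, applied to each coefficient in the
    first variable. *)
Lemma exists_sigma_expression P al c : ahat al = mpolyC 6 c *: Phat P ->
  exists A, al = sigma_hom A.
Proof.
move=> alE; pose p := split_first 6 int al.
pose t k := tag (sym_fundamental (split_first_sym k alE)).
have tE k : comp_mpoly (esym_tuple 6 int) (t k) = p`_k.
  by rewrite /t; case: sym_fundamental => /= ? [].
exists (merge_first (mpolyX int (mnm1 ord0)) (\poly_(k < size p) t k)).
have mE (f : nat -> mpoly 6 int) : merge_first (mpolyX int (mnm1 ord0)) (\poly_(k < size p) f k) =
    \sum_(k < size p) lift_vars 6 int (f k) * mpolyX int (mnm1 ord0) ^+ k.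
  rewrite poly_def rmorph_sum; apply: eq_bigr => k _.
  by rewrite -mul_polyC rmorphM rmorphXn merge_firstX merge_firstC.
rewrite -{1}(split_firstK al) -/p -{1}[p]coefK !mE rmorph_sum; apply: eq_bigr => k _.
by rewrite [RHS](rmorphM sigma_hom) (rmorphXn sigma_hom) sigma_hom0 sigma_hom_lift tE.
Qed.

Definition u2_hom : {rmorphism mpoly 7 int -> Qus} :=
  comp_mpoly [tuple if j == ord0 then (- 4) *: mpolyX rat (mnm1 j) else mpolyX rat (mnm1 j) | j < 7]
    \o map_mpoly intr.

(** Expands sigma_k in the a_i^2 and keeps u_2 as variable. It is injective by algebraic
    independence, so identities in Q[u_2, sigma_1, ..., sigma_6] may be checked after expansion. *)
Definition esym_hom : {rmorphism Qus -> {poly Qa}} :=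
  map_poly (comp_mpoly (esym_tuple 6 rat)) \o split_first 6 rat.

Lemma esym_homE p : esym_hom p = map_poly (comp_mpoly (esym_tuple 6 rat)) (split_first 6 rat p).
Proof. by []. Qed.

Lemma esym_homC c : esym_hom (mpolyC 7 c) = (mpolyC 6 c)%:P.
Proof. by rewrite esym_homE split_firstC map_polyC /= comp_mpolyC. Qed.

Lemma esym_hom0 : esym_hom (mpolyX rat (mnm1 ord0)) = 'X.
Proof. by rewrite esym_homE split_first0 map_polyX. Qed.

Lemma esym_homX (i : 'I_6) : esym_hom (mpolyX rat (mnm1 (lift ord0 i))) = (mesym 6 rat i.+1)%:P.
Proof.
by rewrite esym_homE split_firstX map_polyC /= comp_mpolyXU -tnth_nth tnth_mktuple.
Qed.

Lemma esym_hom_inj : injective esym_hom.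
Proof.
have inj0 p : esym_hom p = 0 -> p = 0.
  rewrite esym_homE => p0; rewrite -(split_firstK p); suff -> : split_first 6 rat p = 0 by rewrite rmorph0.
  apply/polyP => k; rewrite coef0; apply: msym_fundamental_un0.
  by have := congr1 (coefp k) p0; rewrite /= coef_map coef0.
by move=> p q e; apply/eqP; rewrite -subr_eq0; apply/eqP/inj0; rewrite rmorphB e subrr.
Qed.

Lemma ahat_lift_vars (q : mpoly 6 int) : ahat (lift_vars 6 int q) = (map_mpoly intr q)%:P.
Proof.
pose phi : {rmorphism mpoly 6 int -> {poly Qa}} := ahat \o lift_vars 6 int.
pose psi : {rmorphism mpoly 6 int -> {poly Qa}} := polyC \o map_mpoly (intr : int -> rat).
have phiE p : phi p = ahat (lift_vars 6 int p) by [].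
have psiE p : psi p = (map_mpoly intr p)%:P by [].
rewrite -phiE -psiE; apply: eq_rmorph_mpoly_int => i; rewrite [LHS]phiE [RHS]psiE.
by rewrite lift_varsX ahatX map_mpolyX.
Qed.

Lemma esym_u2_hom A : esym_hom (u2_hom A) = ahat (sigma_hom A).
Proof.
pose phi : {rmorphism mpoly 7 int -> {poly Qa}} := esym_hom \o u2_hom.
pose psi : {rmorphism mpoly 7 int -> {poly Qa}} := ahat \o sigma_hom.
have phiE p : phi p = esym_hom (u2_hom p) by [].
have psiE p : psi p = ahat (sigma_hom p) by [].
rewrite -phiE -psiE; apply: eq_rmorph_mpoly_int => j; rewrite [LHS]phiE [RHS]psiE.
have -> : u2_hom (mpolyX int (mnm1 j)) =
    if j == ord0 then (- 4) *: mpolyX rat (mnm1 j) else mpolyX rat (mnm1 j).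
  by rewrite /u2_hom /= map_mpolyX comp_mpolyXU -tnth_nth tnth_mktuple.
have [i ->|->] := unliftP ord0 j.
  by rewrite esym_homX sigma_homX ahat_lift_vars map_mesym.
rewrite eqxx sigma_hom0 ahatX0 -mul_mpolyC rmorphM esym_homC esym_hom0 mul_polyC.
by rewrite mpolyCN mpolyC_nat.
Qed.

Lemma esym_hom_map P : esym_hom (map_mpoly intr P) = Phat P.
Proof.
pose phi : {rmorphism Zus -> {poly Qa}} := esym_hom \o map_mpoly (intr : int -> rat).
have phiE p : phi p = esym_hom (map_mpoly intr p) by [].
rewrite -phiE /Phat; apply: eq_rmorph_mpoly_int => j; rewrite [LHS]phiE map_mpolyX.
have [i ->|->] := unliftP ord0 j; last by rewrite esym_hom0 [RHS]uhom_u2.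
by rewrite esym_homX /= mmapX mmap1U /uvar.
Qed.

Lemma u2_hom_eq P al c A : ahat al = mpolyC 6 c *: Phat P -> al = sigma_hom A ->
  u2_hom A = mpolyC 7 c * map_mpoly intr P.
Proof.
move=> alE AE; apply: esym_hom_inj; rewrite esym_u2_hom -AE alE.
by rewrite (rmorphM esym_hom) esym_homC esym_hom_map mul_polyC.
Qed.

(** * Identification of 2^-136 P with the product of beta'_6 and its conjugate *)

Section BetaPrime.
Variables (L : fieldType) (iota : {rmorphism Qus -> L}).

Let I : {rmorphism {poly Qus} -> {poly L}} := map_poly iota.
Let U : {poly L} := (iota u2)%:P.
Let e (k : nat) : L := iota (sigma k).

(** The fractions 1/2 and 1/4 in t_2, t_3, t_4 enter as images of constants of [Qus]. This relation
    is all that is kept of them, so that [ring] can treat each image as a variable. *)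
Let inv_numeral (k : nat) : k.+1%:R * (iota (mpolyC 7 k.+1%:R^-1))%:P = 1 :> {poly L}.
Proof.
rewrite -polyC_natr -polyCM -(rmorph_nat iota) -rmorphM -mpolyC_nat -mpolyCM.
by rewrite mulfV ?pnatr_eq0 // mpolyC1 rmorph1.
Qed.

Let mapC (c : Qus) : I c%:P = (iota c)%:P. Proof. exact: map_polyC. Qed.
Let mapX : I 'X = 'X. Proof. exact: map_polyX. Qed.
Let mapZ (c : Qus) p : I (c *: p) = (iota c)%:P * I p.
Proof. by rewrite -mul_polyC (rmorphM I) mapC. Qed.
Let map_numeralZ k (p : {poly Qus}) : I (k%:R *: p) = k%:R * I p.
Proof. by rewrite mapZ rmorph_nat polyC_natr. Qed.

Let map_t1 : I t1 = T1 'X (polyC \o e).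
Proof. by rewrite /t1 rmorphB map_numeralZ mapC mapX. Qed.

Let map_t2 : 4 * I t2 = T2 'X U (polyC \o e).
Proof.
have -> : I t2 = - (e 2)%:P + (iota (mpolyC 7 4^-1))%:P * I t1 ^+ 2 + 4 * ('X * I t1) - U.
  rewrite /t2; move: t1 => p; rewrite rmorphB !(rmorphD I) rmorphN map_numeralZ (rmorphM I) mapX.
  by rewrite mapZ !(rmorphXn I) !mapC.
have h := inv_numeral 3; set H := (iota _)%:P in h *.
rewrite /T2 -map_t1 /=; move: (I t1) => p.
by rewrite !(mulrDr 4) [4 * (H * _)]mulrA h; ring.
Qed.

Let map_t3 : 8 * I t3 = T3 'X U (polyC \o e).
Proof.
have -> : I t3 = (e 3)%:P + (iota (mpolyC 7 2^-1))%:P * (I t1 * I t2)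
    - 'X * (I t1 ^+ 2 - 4 * I t2).
  rewrite /t3; move: t1 t2 => p q; rewrite rmorphB (rmorphD I) [I ('X * _)](rmorphM I) rmorphB map_numeralZ mapX.
  by rewrite mapZ !(rmorphXn I) (rmorphM I) !mapC.
have h := inv_numeral 1; set H := (iota _)%:P in h *.
rewrite /T3 -map_t1 -map_t2 /=; move: (I t1) (I t2) => p q.
have -> : p * (4 * q) = 8 * (H * (p * q)) by transitivity (4 * (2 * H) * (p * q)); [rewrite h|]; ring.
ring.
Qed.

Let map_t4 : 64 * I t4 = T4 'X U (polyC \o e).
Proof.
have -> : I t4 = - (e 4)%:P + (iota (mpolyC 7 4^-1))%:P * I t2 ^+ 2
    - 2 * ('X * I t1 * I t2).
  rewrite /t4; move: t1 t2 => p q; rewrite rmorphB (rmorphD I) rmorphN map_numeralZ !(rmorphM I) mapX.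
  by rewrite mapZ !(rmorphXn I) !mapC.
have h := inv_numeral 3; set H := (iota _)%:P in h *.
rewrite /T4 -map_t1 -map_t2 /=; move: (I t1) (I t2) => p q.
have -> : (4 * q) ^+ 2 = 64 * (H * q ^+ 2) by transitivity (16 * (4 * H) * q ^+ 2); [rewrite h|]; ring.
ring.
Qed.

Let map_t5 : 64 * I t5 = T5 'X U (polyC \o e).
Proof.
have -> : I t5 = (e 5)%:P - 'X * I t2 ^+ 2.
  by rewrite /t5; move: t2 => q; rewrite rmorphB (rmorphM I) mapX (rmorphXn I) mapC.
by rewrite /T5 -map_t2 /=; move: (I t2) => q; ring.
Qed.

Definition beta_f (s : L) : {poly L} :=
  map_poly iota t3 ^+ 2 - (4 * iota u2) *: (map_poly iota t4 - (2 * s)%:P).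
Definition beta_g (s : L) : {poly L} :=
  iota u2 *: map_poly iota t5 - s *: map_poly iota t3.

Lemma Fpol_beta s : Fpol (iota u2) s e = 64%:R *: beta_f s.
Proof.
rewrite /Fpol /Fval -map_t3 -map_t4 /beta_f -/U -[map_poly iota t3]/(I t3) -[map_poly iota t4]/(I t4).
rewrite -!mul_polyC !polyCM !polyC_natr -/U; ring.
Qed.

Lemma Gpol_beta s : Gpol (iota u2) s e = 64%:R *: beta_g s.
Proof.
rewrite /Gpol /Gval -map_t3 -map_t5 /beta_g -/U -[map_poly iota t3]/(I t3) -[map_poly iota t5]/(I t5).
rewrite -!mul_polyC !polyC_natr -/U; ring.
Qed.

Hypothesis iota_inj : injective iota.

Let char0 k : k.+1%:R != 0 :> L.
Proof.
rewrite -(rmorph_nat iota) -(rmorph0 iota) (inj_eq iota_inj).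
by rewrite -mpolyC_nat mpolyC_eq0 pnatr_eq0.
Qed.

Let u0 : iota u2 != 0.
Proof. by rewrite -(rmorph0 iota) (inj_eq iota_inj) -msupp_eq0 msuppX. Qed.

(** Each polynomial is scaled by 64; the degrees 6 and 5 give 64^(5 + 6) = 2^66. *)
Lemma resultant_FG_beta s :
  resultant (Fpol (iota u2) s e) (Gpol (iota u2) s e) =
  2%:R ^+ 66 * resultant (beta_f s) (beta_g s).
Proof.
have c0 : 64%:R != 0 :> L by apply: char0.
have [|sF _] := has_top_lead _ (top_Fpol (iota u2) s e).
  by rewrite expf_neq0 //; apply: char0.
have [|sG _] := has_top_lead _ (top_Gpol (iota u2) s e).
  by rewrite mulf_neq0 // oppr_eq0 expf_neq0 //; apply: char0.
rewrite Fpol_beta Gpol_beta resultantZ //.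
move: sF sG; rewrite Fpol_beta Gpol_beta !size_scale // => -> ->.
have -> : 64%:R = 2%:R ^+ 6 :> L by rewrite -natrX.
by rewrite -exprM -exprM -exprD.
Qed.

Let inv_exp2 n : iota (mpolyC 7 (2%:R ^+ n)^-1) * 2%:R ^+ n = 1.
Proof.
rewrite -(rmorph_nat iota) -(rmorphXn iota) -(rmorphM iota) -mpolyC_nat.
rewrite -(rmorphXn (@mpolyC 7 rat)) -mpolyCM mulVf ?mpolyC1 ?rmorph1 //.
by rewrite expf_neq0 // pnatr_eq0.
Qed.

(** Applied with k = 2^-136 and t = 2^66; the 16 comes from the two denominators 4 u_2^6, and -136 +
    66 + 66 + 4 = 0. *)
Let cancel_scales (k t p r r' u : L) : u != 0 -> k * (t * t * 16%:R) = 1 ->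
  p * u ^+ 12 = t * r * (t * r') -> k * p = r / (4%:R * u ^+ 6) * (r' / (4%:R * u ^+ 6)).
Proof.
move=> un0 kt pE; have four0 := char0 3.
apply: (mulIf (expf_neq0 12 un0)); rewrite /= -[LHS]mulrA pE.
have -> : r / (4%:R * u ^+ 6) * (r' / (4%:R * u ^+ 6)) * u ^+ 12 = r * r' / 16%:R.
  by have sixteen0 := char0 15; field; rewrite un0 four0 sixteen0.
apply: (mulIf (char0 15)); rewrite /= divfK ?(char0 15) //.
by transitivity (k * (t * t * 16%:R) * (r * r')); [ring | rewrite kt mul1r].
Qed.

Lemma beta_product P s : Znorm Dres = P * zu2 ^+ 12 -> s ^+ 2 = iota (u2 * t6) ->
  iota (mpolyC 7 (2%:R ^+ 136)^-1 * map_mpoly intr P) = beta'6 iota s * beta'6 iota (- s).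
Proof.
move=> PE s2; pose phi : {rmorphism Zus -> L} := iota \o map_mpoly (intr : int -> rat).
have phiE p : phi p = iota (map_mpoly intr p) by [].
have phi_u : phi zu2 = iota u2 by rewrite phiE map_mpolyX.
have phi_sigma k : phi (zsigma k) = e k by rewrite phiE map_mpolyX.
have s2' : s ^+ 2 = - (phi zu2 * phi (zsigma 6)).
  by rewrite s2 phi_u phi_sigma rmorphM /t6 rmorphN mulrN.
have Dval r : (map_poly phi Dres).[r] = 2%:R ^+ 66 * resultant (beta_f r) (beta_g r).
  rewrite Dres_resultant //; last by rewrite phi_u.
  have ee k : (0 < k < 7)%N -> (phi \o zsigma) k = e k by move=> _; apply: phi_sigma.
  by rewrite phi_u (eq_in_Fpol _ _ ee) (eq_in_Gpol _ _ ee) resultant_FG_beta.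
have phiM (p q : Zus) k : phi (p * q ^+ k) = phi p * phi q ^+ k by rewrite rmorphM rmorphXn.
have := morph_Znorm Dres s2'; rewrite PE phiM phi_u !Dval => E.
rewrite (rmorphM iota) -phiE; apply: cancel_scales E; first exact: u0.
have -> : 16%:R = 2%:R ^+ 4 :> L by rewrite -natrX.
rewrite -!exprD; exact: inv_exp2.
Qed.

End BetaPrime.

Theorem mainTheorem9 (R : realType) (alpha'6 : mpoly 7 int) :
  is_alpha' R alpha'6 ->
  exists A : mpoly 7 int,
    sigma_expression alpha'6 A /\
    forall (L : fieldType) (iota : {rmorphism Qus -> L}) (s : L),
      injective iota -> s ^+ 2 = iota (u2 * t6) ->
      iota (in_u2 A) = beta'6 iota s * beta'6 iota (- s).
Proof.
move=> [irr monic _ al0]; have [P PE] := exists_Pz.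
have [Q alQ] := dvdp_Phat_ahat PE al0.
have alE := ahat_eq PE irr monic alQ.
have [A AE] := exists_sigma_expression alE.
exists A; split=> // L iota s iota_inj s2.
have -> : in_u2 A = u2_hom A by [].
by rewrite (u2_hom_eq alE AE) (beta_product iota_inj PE s2).
Qed.
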